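(* Let $P\subset\mathbb{R}^2$ be an $(r,R)$-system in $\mathbb{R}^2$ with $R/r\le 2\sqrt2$. Consider a Delone triangulation of $\mathbb{R}^2$ associated to $P$ (if there are Delone polygons with more than three sides, they are triangulated arbitrarily). Then the Delone triangles can be grouped in (pairwise disjoint) groups, such that each group (1) is a single non-obtuse triangle $T$, or (2) is a single obtuse triangle $T$ of area at least $2r^2$, or (3) consists of one non-obtuse triangle $T$ and one, two or three obtuse triangles $T_i$, whose longest sides coincide with some sides of $T$, these two, three or four triangles having an average area at least $2r^2$, or (4) consists of an obtuse triangle $T$ and one or two further obtuse triangles $T_i$, whose longest sides coincide with some sides of $T$ but not with the longest side of $T$, these two or three triangles having an average area at least $2r^2$. In particular, if the infimum of the areas of the non-obtuse Delone triangles is $V_0$, then the average area of the Delone triangles is at least $\min\{V_0,2r^2\}$. This bound is sharp.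
   Context: For $0<r<R<\infty$, a set $P=\{p_1,p_2,\dots\}\subset\mathbb{R}^2$ is an $(r,R)$-system if the balls with centres at the points of $P$ and radii $r$ form a packing in $\mathbb{R}^2$ (pairwise disjoint interiors) and the balls with these centres and radii $R$ form a covering of $\mathbb{R}^2$. The Delone polygons of $P$ are the convex hulls of the sets $P\cap\partial D$ (when these are two-dimensional), where $D$ is a closed disc with no point of $P$ in its interior; they tile $\mathbb{R}^2$ edge to edge, and polygons with more than three sides are cut into triangles by diagonals. A triangle is obtuse if it has an angle greater than $\pi/2$. The average area of the Delone triangles is the (lower) limit, as $\rho\to\infty$, of the average area of the Delone triangles contained in the disc of radius $\rho$ about the origin. ''Sharp'' means that the inequality cannot be improved in general: there are $(r,R)$-systems satisfying the hypotheses for which the average area equals $\min\{V_0,2r^2\}$. *)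

(* Defs.v *)
From mathcomp Require Import all_boot all_order all_algebra finmap.
From mathcomp Require Import all_classical all_reals all_analysis.

Set Implicit Arguments.
Unset Strict Implicit.
Unset Printing Implicit Defensive.

Import Order.TTheory GRing.Theory Num.Theory.
Import numFieldNormedType.Exports.

Local Open Scope classical_set_scope.
Local Open Scope ring_scope.

Notation plane K := 'rV[K]_2 (only parsing).

Section Plane.
Context {K : realType}.
Implicit Types (a b c u v : plane K) (A : set (plane K)).

Definition dot u v : K := u 0 0 * v 0 0 + u 0 1 * v 0 1.
Definition cross u v : K := u 0 0 * v 0 1 - u 0 1 * v 0 0.

(* The library norm on 'rV[K]_2 is the sup norm, hence a separate Euclidean
   norm; both induce the same topology. *)
Definition enorm u : K := Num.sqrt (dot u u).
Definition edist a b : K := enorm (b - a).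

Definition disc c (s : K) : set (plane K) := [set x | edist c x <= s].
Definition open_disc c (s : K) : set (plane K) := [set x | edist c x < s].
Definition circle c (s : K) : set (plane K) := [set x | edist c x = s].

Definition hull A : set (plane K) :=
  smallest (fun C : set (convex_lmodType (plane K)) => convex_set C) A.

(* The angle at [a] of the triangle [a b c]. *)
Definition angle a b c : K :=
  acos (dot (b - a) (c - a) / (edist a b * edist a c)).

End Plane.

(* Discs of radius [r] pack when their interiors are disjoint. *)
Definition rR_system (K : realType) (r R : K) (P : set (plane K)) : Prop :=
  [/\ 0 < r, r < R,
      forall p q, P p -> P q -> p <> q ->
        open_disc p r `&` open_disc q r = set0
    & \bigcup_(p in P) disc p R = setT].

(* A triangle is given by its vertices in some order; [delone_triangulation]
   below keeps a single ordering of each of its triangles. *)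
Notation triangle K := {ffun 'I_3 -> plane K} (only parsing).

Section Triangle.
Context {K : realType}.
Implicit Types (T U : triangle K) (S : set (plane K)) (i j : 'I_3).

Definition vertices T : set (plane K) := range T.

Definition nondegenerate T : Prop := cross (T 1 - T 0) (T 2 - T 0) != 0.

Definition area T : K := `|cross (T 1 - T 0) (T 2 - T 0)| / 2.

Definition obtuse T : Prop :=
  exists i, pi / 2 < angle (T i) (T (ordS i)) (T (ord_pred i)).

(* A side is represented by the set of its two endpoints; [side T i] is the
   side opposite to the vertex [T i]. *)
Definition side T i : set (plane K) := [set T (ordS i); T (ord_pred i)].
Definition side_length T i : K := edist (T (ordS i)) (T (ord_pred i)).

Definition is_side T S : Prop := exists i, S = side T i.
Definition is_longest_side T S : Prop :=
  exists i, S = side T i /\ forall j, side_length T j <= side_length T i.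

Definition mean_area (s : seq (triangle K)) : K :=
  (\sum_(T <- s) area T) / (size s)%:R.

End Triangle.

Section Delone.
Context {K : realType}.
Implicit Types (P V : set (plane K)) (TT : set (triangle K)).

(* The vertex sets of the Delone polygons of [P]; the last condition says that
   the hull of [V] is two-dimensional. *)
Definition delone_vertices P V : Prop :=
  exists (c : plane K) (s : K),
    [/\ P `&` open_disc c s = set0,
        V = P `&` circle c s
      & exists x y z, [/\ V x, V y, V z & cross (y - x) (z - x) != 0]].

(* [V] is meant to be a set of concyclic points: no point of [V] is then
   interior to a segment joining two others, so that a tiling of [hull V] by
   triangles with vertices in [V] is a dissection of it by diagonals. *)
Definition polygon_triangulation V TT : Prop :=
  [/\ forall T, TT T -> vertices T `<=` V /\ nondegenerate T,
      forall T U, TT T -> TT U -> T <> U ->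
        interior (hull (vertices T)) `&` interior (hull (vertices U)) = set0
    & \bigcup_(T in TT) hull (vertices T) = hull V].

Definition delone_triangulation P TT : Prop :=
  (forall T, TT T -> exists2 V, delone_vertices P V & vertices T `<=` V) /\
  (forall V, delone_vertices P V ->
     polygon_triangulation V (TT `&` [set T | vertices T `<=` V])).

(* [fset_set] returns the empty set on infinite sets, but only finitely many
   triangles of a Delone triangulation of an (r,R)-system lie in a disc. *)
Definition average_area TT : \bar K :=
  limf_einf (fun rho : K =>
      (mean_area (fset_set
         (TT `&` [set T | hull (vertices T) `<=` disc 0 rho])))%:E)
    (pinfty_nbhs K).

(* This is +oo when all the triangles are obtuse. *)
Definition inf_nonobtuse_area TT : \bar K :=
  ereal_inf [set (area T)%:E | T in TT `&` [set T | ~ obtuse T]].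

End Delone.

Inductive admissible_group (K : realType) (r : K) : set (triangle K) -> Prop :=
| GroupNonObtuse T of
    ~ obtuse T : admissible_group r [set T]
| GroupObtuse T of
    obtuse T & 2 * r ^+ 2 <= area T : admissible_group r [set T]
| GroupAroundNonObtuse T (s : seq (triangle K)) of
    ~ obtuse T &
    (1 <= size s <= 3)%N &
    uniq (T :: s) &
    (forall U, U \in s ->
       obtuse U /\ exists S, is_longest_side U S /\ is_side T S) &
    2 * r ^+ 2 <= mean_area (T :: s) :
    admissible_group r [set` T :: s]
| GroupAroundObtuse T (s : seq (triangle K)) of
    obtuse T &
    (1 <= size s <= 2)%N &
    uniq (T :: s) &
    (forall U, U \in s ->
       obtuse U /\ exists S,
         [/\ is_longest_side U S, is_side T S & ~ is_longest_side T S]) &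
    2 * r ^+ 2 <= mean_area (T :: s) :
    admissible_group r [set` T :: s].

(* Main.v *)
Require Import Defs.
From mathcomp Require Import all_boot all_order all_algebra.
From mathcomp Require Import all_classical all_reals all_analysis.
From mathcomp Require Import ring lra zify.

Set Implicit Arguments.
Unset Strict Implicit.
Unset Printing Implicit Defensive.

Import Order.TTheory GRing.Theory Num.Theory.
Import numFieldNormedType.Exports.

Local Open Scope classical_set_scope.
Local Open Scope ring_scope.

(** Lengths are measured in units of [r], so that sides are at least [2] and
    circumradii at most [2 sqrt 2].  Call a triangle small when it is obtuse and
    its area is less than [2].

    The circumcentre of a small triangle [U] lies beyond its longest side, so the
    triangle [T] on the other side of that side has an acute angle opposite to it
    ([leans_acute]).  Hence [T] is either non-obtuse, or obtuse with another,
    longer, longest side.  In the latter case the bound on the circumradius and a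
    non-longest side of length at least [2 sqrt 2] force the area of [T] to be at
    least [2]; so [T] is never small ([leans_not_small]).  Attaching every small
    triangle to the triangle across its longest side therefore produces groups made
    of one triangle [T] that is not small and at most one small triangle on each
    side of [T], the longest side being excluded when [T] is obtuse.  It remains to
    see that [T] makes up for the deficits, from [2], of the areas of the small
    triangles around it.  The deficit of a small triangle is bounded by a function
    of its longest side alone ([obtuse_deficit]), and the area of [T] is bounded
    below by the formula of Heron together with the bound on the circumradius
    ([nonobtuse_one_child] and the four lemmas after it).

    This needs a neighbour across every side.  The circles through two points [p]
    and [q] form a pencil: the point [x] is on the circle of parameter [t] when
    [power p q x = t * side_of p q x], and inside it when the left-hand side is
    smaller.  Starting from an empty circle and increasing [t] until a point of the
    system is met gives a Delone polygon on the chosen side of [p q]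
    ([pencil_grow]).  One of its triangles covers points arbitrarily close to the
    midpoint of [p q], and it has [p q] as a side, for otherwise it would overlap
    the triangle already present ([across_edge]).  Conversely two triangles on the
    same side of [p q] have empty circumcircles of the same pencil, hence the same
    circumcircle, hence belong to the same polygon and coincide ([edge_unique]).

    For the average, the mean area over each group is at least the minimum
    in question, and a group that meets a disc without being contained in it has
    all its vertices near the boundary circle.  A disc of radius [rho] contains at
    most a constant times [rho ^ (3/2)] triangles of such groups
    ([boundary_count]), against at least a constant times [rho ^ 2] triangles in
    all ([in_disc_count]).

    Equality holds for the integer lattice with [r = 1/2] and [R = 1]: its Delone
    polygons are the unit squares, whose halves are right triangles of area
    [1/2 = 2 r ^ 2]. *)

Local Notation edist := Defs.edist.
Local Notation nondegenerate := Defs.nondegenerate.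

Local Ltac coords := rewrite /dot /cross ?mxE.

(** * Area inequalities *)
Section AreaBounds.
Variable K : realFieldType.
Implicit Types x y z A d : K.

(** Sixteen times the squared area, in terms of the squares of the sides. *)
Definition heron16 x y z : K := 4 * x * y - (z - x - y) ^+ 2.

Lemma le_of_sqr_le A (L : K) : 0 <= A -> L ^+ 2 <= A ^+ 2 -> L <= A.
Proof.
move=> A0 h; case: (leP L A) => // AL.
have : A ^+ 2 < L ^+ 2 by rewrite ltr_pXn2r // ?nnegrE //; lra.
by lra.
Qed.

(** An obtuse triangle of squared longest side [z], with the other sides at least
    [2] and circumradius at most [2 sqrt 2], has squared area at least
    [z (16 - z) / 16] and at least [z / 8].  The two bounds agree for [z = 14],
    where the area is [sqrt 7 / 2]; the chord of the first one on [8, 14] shows that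
    the deficit is at most [(2 - sqrt 7 / 2) * min 1 ((z - 8) / 6)], and the
    constants below round the coefficients up. *)
Definition deficit_bound z d := d <= 17/25 /\ d <= 3/25 * (z - 8).

Lemma obtuse_deficit x y z A : 4 <= x -> 4 <= y -> x + y <= z -> 0 <= A ->
  16 * A ^+ 2 = heron16 x y z -> x * y * z <= 128 * A ^+ 2 ->
  deficit_bound z (2 - A).
Proof.
rewrite /heron16 => x4 y4 xyz A0 hA cA.
have z8 : 8 <= z by lra.
have a1 : z * (16 - z) <= 16 * A ^+ 2.
  rewrite hA.
  have : 0 <= (x - 4) * (y - 4) by apply: mulr_ge0; lra.
  have : 0 <= (x - 4 + (y - 4)) * (z - x - y) by apply: mulr_ge0; lra.
  have := sqr_ge0 (x - 4 + (y - 4)).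
  nra.
have a2 : z <= 8 * A ^+ 2.
  have : 0 <= (x * y - 16) * z by apply: mulr_ge0; nra.
  nra.
have A1 : 33/25 <= A.
  apply: le_of_sqr_le => //.
  case: (leP z 14) => z14; last by lra.
  nra.
split; first by lra.
suff : 2 - 3/25 * (z - 8) <= A by lra.
case: (leP z 14) => z14; last by lra.
apply: le_of_sqr_le => //; nra.
Qed.

(** Equality holds for the right triangle with squared hypotenuse [x] and a leg of
    length [2].  The area increases with the shorter of the other two sides, which
    can be decreased until its length is [2] or the triangle becomes right. *)
Lemma nonobtuse_sqr_area x y z A : 8 <= x -> 4 <= y -> 4 <= z ->
  x <= y + z -> y <= x + z -> z <= x + y ->
  16 * A ^+ 2 = heron16 x y z -> x - 4 <= A ^+ 2.
Proof.
rewrite /heron16 => x8 y4 z4 xyz yxz zxy hA.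
suff : 16 * (x - 4) <= 4 * x * y - (z - x - y) ^+ 2 by lra.
wlog yz : y z y4 z4 xyz yxz zxy {hA} / y <= z => [hw|].
  case: (leP y z) => yz; first exact: hw.
  have := hw z y; nra.
case: (leP z (x - 4)) => zx.
  (* comparison with [y = x - z], when the angle opposite to the side [x] is right *)
  have : 0 <= (y + z - x) * (x + z - y) by apply: mulr_ge0; lra.
  have : 0 <= (z - 4) * (x - z - 4) by apply: mulr_ge0; lra.
  have : 0 <= (z - y) * (y + z - x) by apply: mulr_ge0; lra.
  nra.
case: (leP z (x + 4)) => zx'.
  have : 0 <= (y - 4) * (z + x - y) by apply: mulr_ge0; lra.
  have : 0 <= (z - x + 4) * (x + 4 - z) by apply: mulr_ge0; lra.
  have : 0 <= (y - 4) * (z + x - 4)  by apply: mulr_ge0; lra.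
  nra.
have : 0 <= (x + y - z) * (z + x - y) by apply: mulr_ge0; lra.
have : 0 <= (x + y - z) * (z + y - x) by apply: mulr_ge0; lra.
nra.
Qed.

Lemma nonobtuse_one_child x y z A d :
  8 <= x -> 4 <= y -> 4 <= z -> x <= y + z -> y <= x + z -> z <= x + y ->
  0 <= A -> 16 * A ^+ 2 = heron16 x y z ->
  deficit_bound x d -> 2 + d <= A.
Proof.
move=> x8 y4 z4 h1 h2 h3 A0 hA [d1 d2].
have h := nonobtuse_sqr_area x8 y4 z4 h1 h2 h3 hA.
case: (leP x 14) => x14.
  apply: (@le_trans _ _ (2 + 3/25 * (x - 8))); first by lra.
  apply: le_of_sqr_le => //; nra.
apply: (@le_trans _ _ (2 + 17/25)); first by lra.
apply: le_of_sqr_le => //; lra.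
Qed.

(** When the squares of the two sides differ by at most [4], the area is compared
    with the triangle whose third side is [2]; otherwise the larger side alone
    gives enough by [nonobtuse_sqr_area]. *)
Lemma nonobtuse_two_children x y z A d e :
  8 <= x -> 8 <= y -> 4 <= z -> x <= y + z -> y <= x + z -> z <= x + y ->
  0 <= A -> 16 * A ^+ 2 = heron16 x y z ->
  deficit_bound x d -> deficit_bound y e -> 2 + d + e <= A.
Proof.
wlog yx : x y d e / y <= x => [hw|] x8 y8 z4 h1 h2 h3 A0 hA [d1 d2] [e1 e2].
  case: (leP y x) => yx; first by apply: (hw x y).
  suff : 2 + e + d <= A by lra.
  apply: (hw y x) => //; rewrite ?hA ?/heron16; lra.
move: hA; rewrite /heron16 => hA.
case: (leP (x - y) 4) => xy.
  have hA2 : x + 3 * y - 4 <= 4 * A ^+ 2.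
    have : 0 <= (z - 4) * (x + y - z) by apply: mulr_ge0; lra.
    have : 0 <= (z - 4) * (x + y - 4) by apply: mulr_ge0; lra.
    have : 0 <= (x - y) * (4 - (x - y)) by apply: mulr_ge0; lra.
    nra.
  case: (leP y 13) => y13.
    case: (leP x 14) => x14.
      apply: (@le_trans _ _ (2 + 3/25 * (x + y - 16))); first by lra.
      apply: le_of_sqr_le => //; nra.
    apply: (@le_trans _ _ (2 + 17/25 + 3/25 * (y - 8))); first by lra.
    apply: le_of_sqr_le => //; nra.
  apply: (@le_trans _ _ (2 + 17/25 + 17/25)); first by lra.
  apply: le_of_sqr_le => //; nra.
have hA2 : x - 4 <= A ^+ 2.
  by apply: (@nonobtuse_sqr_area x y z) => //; lra.
case: (leP x 14) => x14.
  apply: (@le_trans _ _ (2 + 3/25 * (x - 8) + 3/25 * (x - 12))); first by lra.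
  apply: le_of_sqr_le => //; nra.
case: (leP x 17) => x17.
  apply: (@le_trans _ _ (2 + 17/25 + 3/25 * (x - 12))); first by lra.
  apply: le_of_sqr_le => //; nra.
apply: (@le_trans _ _ (2 + 17/25 + 17/25)); first by lra.
apply: le_of_sqr_le => //; lra.
Qed.

(** The largest angle is between [pi / 3] and [pi / 2], and it is enclosed by the
    two smaller sides; so the squared area is at least [3 / 16] times the product
    of their squares. *)
Lemma nonobtuse_three_children x y z A d e f :
  8 <= x -> 8 <= y -> 8 <= z -> x <= y + z -> y <= x + z -> z <= x + y ->
  0 <= A -> 16 * A ^+ 2 = heron16 x y z ->
  deficit_bound x d -> deficit_bound y e -> deficit_bound z f ->
  2 + d + e + f <= A.
Proof.
wlog yx : x y d e / y <= x => [hw|].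
  move=> x8 y8 z4 h1 h2 h3 A0 hA dx ey fz.
  case: (leP y x) => yx; first exact: (hw x y).
  suff : 2 + e + d + f <= A by lra.
  apply: (hw y x) => //; rewrite ?hA ?/heron16; lra.
wlog zx : x z d f yx / z <= x => [hw|].
  move=> x8 y8 z4 h1 h2 h3 A0 hA dx ey fz.
  case: (leP z x) => zx; first exact: (hw x z).
  suff : 2 + f + e + d <= A by lra.
  apply: (hw z x) => //; rewrite ?hA ?/heron16; lra.
wlog zy : y z e f yx zx / z <= y => [hw|].
  move=> x8 y8 z4 h1 h2 h3 A0 hA dx ey fz.
  case: (leP z y) => zy; first exact: (hw y z).
  suff : 2 + d + f + e <= A by lra.
  apply: (hw z y) => //; rewrite ?hA ?/heron16; lra.
rewrite /heron16 => x8 y8 z8 h1 h2 h3 A0 hA [d1 d2] [e1 e2] [f1 f2].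
have hA2 : 3 * y * z <= 16 * A ^+ 2.
  have : 0 <= (y + z - x) * (x - z) by apply: mulr_ge0; lra.
  have : 0 <= (x - y) * (x - z) by apply: mulr_ge0; lra.
  have : 0 <= (x - y) * z by apply: mulr_ge0; lra.
  nra.
case: (leP y 10) => y10.
  apply: (@le_trans _ _ (2 + 17/25 + 6/25 + 6/25)); first by lra.
  apply: le_of_sqr_le => //; nra.
case: (leP z 10) => z10.
  apply: (@le_trans _ _ (2 + 17/25 + 17/25 + 6/25)); first by lra.
  apply: le_of_sqr_le => //; nra.
apply: (@le_trans _ _ (2 + 17/25 + 17/25 + 17/25)); first by lra.
apply: le_of_sqr_le => //; nra.
Qed.

(** For fixed [x] the excess [w = z - x - y] makes the triangle flatter in Heron's
    formula, whereas it increases the product of the sides, which the bound on the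
    circumradius turns into a lower bound on the area.  The first bound is good
    enough for [w <= 4], the second one beyond. *)
Lemma obtuse_one_child x y z A d :
  8 <= x -> 4 <= y -> x + y <= z ->
  0 <= A -> 16 * A ^+ 2 = heron16 x y z -> x * y * z <= 128 * A ^+ 2 ->
  deficit_bound x d -> 2 + d <= A.
Proof.
rewrite /heron16 => x8 y4 h1 A0 hA cA [d1 d2].
set w := z - x - y in hA; have w0 : 0 <= w by rewrite /w; lra.
have zE : z = x + y + w by rewrite /w; lra.
have [hA2|hA2] : x - 1 <= A ^+ 2 \/ x * (x + 8) <= 32 * A ^+ 2.
  case: (leP w 4) => w4; [left | right].
    have : 0 <= x * (y - 4) by apply: mulr_ge0; lra.
    nra.
  have : 0 <= x * (y - 4) by apply: mulr_ge0; lra.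
  have : 0 <= (x * y - 4 * x) * (x + y + w) by apply: mulr_ge0; nra.
  rewrite zE in cA; nra.
- case: (leP x 14) => x14.
    apply: (@le_trans _ _ (2 + 3/25 * (x - 8))); first by lra.
    apply: le_of_sqr_le => //; nra.
  apply: (@le_trans _ _ (2 + 17/25)); first by lra.
  apply: le_of_sqr_le => //; lra.
- case: (leP x 14) => x14.
    apply: (@le_trans _ _ (2 + 3/25 * (x - 8))); first by lra.
    apply: le_of_sqr_le => //; nra.
  apply: (@le_trans _ _ (2 + 17/25)); first by lra.
  apply: le_of_sqr_le => //; nra.
Qed.

Lemma obtuse_two_children x y z A d e :
  8 <= x -> 8 <= y -> x + y <= z ->
  0 <= A -> 16 * A ^+ 2 = heron16 x y z -> x * y * z <= 128 * A ^+ 2 ->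
  deficit_bound x d -> deficit_bound y e -> 2 + d + e <= A.
Proof.
rewrite /heron16 => x8 y8 h1 A0 hA cA [d1 d2] [e1 e2].
set w := z - x - y in hA; have w0 : 0 <= w by rewrite /w; lra.
have zE : z = x + y + w by rewrite /w; lra.
apply: (@le_trans _ _ (2 + 17/25 + 17/25)); first by lra.
apply: le_of_sqr_le => //.
have xy : 64 <= x * y by nra.
(* [33/5] is between the value of [w] from which the bound on the circumradius gives
   the area [84/25] and the value up to which the formula of Heron does *)
case: (leP w (33/5)) => w4; first by nra.
have : 0 <= (x * y - 64) * (x + y + w) by apply: mulr_ge0; lra.
rewrite zE in cA; nra.
Qed.

End AreaBounds.

(** * Euclidean distance and pencils of circles *)
Section PlaneGeometry.
Context {K : realType}.
Implicit Types (a b c p q u v x y z : plane K) (s t : K).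

Lemma plane_eqP u v : u 0 0 = v 0 0 -> u 0 1 = v 0 1 -> u = v.
Proof.
move=> h0 h1; apply/rowP => j.
case: j => [[|[|//]] hj].
  by have -> : Ordinal hj = 0 by apply: val_inj.
by have -> : Ordinal hj = 1 by apply: val_inj.
Qed.

Definition sqd a b : K := dot (b - a) (b - a).

Lemma sqd_ge0 a b : 0 <= sqd a b.
Proof. by rewrite /sqd /dot addr_ge0 // -expr2 sqr_ge0. Qed.

Lemma sqdC a b : sqd a b = sqd b a.
Proof. by rewrite /sqd; coords; ring. Qed.

Lemma sqd_gt0 a b : a <> b -> 0 < sqd a b.
Proof.
move=> ab; rewrite lt_neqAle sqd_ge0 andbT; apply/eqP => h.
apply: ab; move: h; rewrite /sqd; coords => h.
move/esym/eqP: h; rewrite -!expr2 paddr_eq0 ?sqr_ge0 // !sqrf_eq0 !subr_eq0.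
by move=> /andP[/eqP h0 /eqP h1]; apply: plane_eqP.
Qed.

Lemma edist_sqr a b : edist a b ^+ 2 = sqd a b.
Proof. by rewrite sqr_sqrtr // sqd_ge0. Qed.

Lemma edist_ge0 a b : 0 <= edist a b.
Proof. exact: sqrtr_ge0. Qed.

Lemma edist_le a b s : 0 <= s -> (edist a b <= s) = (sqd a b <= s ^+ 2).
Proof. by move=> s0; rewrite -edist_sqr ler_pXn2r // nnegrE edist_ge0. Qed.

Lemma edist_lt a b s : 0 <= s -> (edist a b < s) = (sqd a b < s ^+ 2).
Proof. by move=> s0; rewrite -edist_sqr ltr_pXn2r // nnegrE edist_ge0. Qed.

Lemma edist_eq a b s : 0 <= s -> edist a b = s <-> sqd a b = s ^+ 2.
Proof.
move=> s0; split=> [<-|h]; first by rewrite edist_sqr.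
by apply/eqP; rewrite eq_le edist_le // h lexx leNgt edist_lt // h ltxx.
Qed.

Lemma enorm_triangle u v : enorm (u + v) <= enorm u + enorm v.
Proof.
have dE (w : plane K) : enorm w ^+ 2 = dot w w.
  by rewrite sqr_sqrtr //; have := sqd_ge0 0 w; rewrite /sqd subr0.
have n0 (w : plane K) : 0 <= enorm w := sqrtr_ge0 _.
apply: le_of_sqr_le; first exact: addr_ge0.
have cs : dot u v <= enorm u * enorm v.
  apply: le_of_sqr_le; first exact: mulr_ge0.
  rewrite exprMn !dE; coords.
  by have := sqr_ge0 (u 0 0 * v 0 1 - u 0 1 * v 0 0); nra.
rewrite sqrrD !dE; move: cs; coords; nra.
Qed.

Lemma edist_triangle b a c : edist a c <= edist a b + edist b c.
Proof.
rewrite /edist; have -> : c - a = (b - a) + (c - b) by rewrite [RHS]addrC subrKA.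
exact: enorm_triangle.
Qed.

Lemma edistC a b : edist a b = edist b a.
Proof. by rewrite /edist /enorm -/(sqd a b) sqdC. Qed.

(** Twice the signed area of [p q x]; its sign tells the side of the line [p q]. *)
Definition side_of p q x : K := cross (q - p) (x - p).
(** The power of [x] with respect to the circle of diameter [p q]. *)
Definition power p q x : K := dot (x - p) (x - q).

(** The difference of the powers of [x] with respect to two circles through [p] and
    [q] is an affine function vanishing on the line [p q]. *)
Lemma pencil_param p q c : p <> q -> sqd c p = sqd c q ->
  exists t, forall x, sqd c x - sqd c p = power p q x - t * side_of p q x.
Proof.
move=> /sqd_gt0 d0 h; set d := q - p; set e := 2 *: c - p - q.
have de : dot d e = 0.
  have -> : dot d e = sqd c p - sqd c q by rewrite /sqd; coords; ring.
  by rewrite h subrr.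
exists (cross d e / dot d d) => x.
have d1 : dot d d != 0 by rewrite gt_eqF.
apply: (mulfI d1); apply: subr0_eq.
have -> : dot d d * (power p q x - cross d e / dot d d * side_of p q x) =
    dot d d * power p q x - cross d e * side_of p q x by field.
have -> : dot d d * (sqd c x - sqd c p) -
    (dot d d * power p q x - cross d e * side_of p q x) =
    - dot d e * dot d (x - p) by rewrite /sqd /power /side_of /d /e; coords; ring.
by rewrite de oppr0 mul0r.
Qed.

Lemma pencil_center p q t : exists c, forall x,
  sqd c x - sqd c p = power p q x - t * side_of p q x.
Proof.
exists (\row_j (if j == 0 then (p 0 0 + q 0 0 - t * (q 0 1 - p 0 1)) / 2
        else (p 0 1 + q 0 1 + t * (q 0 0 - p 0 0)) / 2)) => x.
rewrite /sqd /power /side_of; coords => /=.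
by field.
Qed.

(** The square of the identity [a b c = 4 R A] for a triangle with sides [a], [b],
    [c], area [A] and circumradius [R]. *)
Lemma circumradius_cross c p q x : sqd c p = sqd c x -> sqd c q = sqd c x ->
  sqd p q * sqd q x * sqd p x = 4 * cross (q - p) (x - p) ^+ 2 * sqd c x.
Proof.
move=> hp hq.
set u := p - x; set v := q - x; set w := c - x.
have hu : dot u u = 2 * dot w u.
  by move: hp; rewrite /sqd /u /w; coords => h; lra.
have hv : dot v v = 2 * dot w v.
  by move: hq; rewrite /sqd /v /w; coords => h; lra.
have -> : cross (q - p) (x - p) = cross u v by rewrite /u /v; coords; ring.
have -> : sqd c x = dot w w by rewrite /sqd /w; coords; ring.
have -> : sqd q x = dot v v by rewrite /sqd /v; coords; ring.
have -> : sqd p x = dot u u by rewrite /sqd /u; coords; ring.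
have -> : sqd p q = dot u u + dot v v - 2 * dot u v.
  by rewrite /sqd /u /v; coords; ring.
have -> : 4 * cross u v ^+ 2 * dot w w =
    dot u u * (2 * dot w v) ^+ 2 + dot v v * (2 * dot w u) ^+ 2
    - 2 * dot u v * (2 * dot w u) * (2 * dot w v).
  coords; ring.
rewrite -hu -hv; ring.
Qed.

End PlaneGeometry.

(** * Triangles and barycentric coordinates *)
Section Indices.
Implicit Types i j : 'I_3.

Lemma ord3P i j : [\/ j = i, j = ordS i | j = ord_pred i].
Proof.
case: i j => [[|[|[|//]]] hi] [[|[|[|//]]] hj];
  solve [exact: (Or31 _ _ (val_inj _)) | exact: (Or32 _ _ (val_inj _))
        | exact: (Or33 _ _ (val_inj _))].
Qed.

Lemma ordSS i : ordS (ordS i) = ord_pred i.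
Proof. by case: i => [[|[|[|//]]] hi]; apply: val_inj. Qed.

Lemma ord_predP i : ord_pred (ord_pred i) = ordS i.
Proof. by case: i => [[|[|[|//]]] hi]; apply: val_inj. Qed.

Lemma ordS_neq i : ordS i != i.
Proof. by case: i => [[|[|[|//]]] hi]. Qed.

Lemma ord_pred_neq i : ord_pred i != i.
Proof. by case: i => [[|[|[|//]]] hi]. Qed.

Lemma sum3 (V : nmodType) i (F : 'I_3 -> V) :
  \sum_j F j = F i + F (ordS i) + F (ord_pred i).
Proof.
rewrite (bigD1 i) //= (bigD1 (ordS i)) ?ordS_neq //= (bigD1 (ord_pred i)) /=.
  rewrite big1 ?addr0 ?addrA // => j; case: (ord3P i j) => ->; rewrite ?eqxx ?andbF //.
by rewrite ord_pred_neq /= -ordSS ordS_neq.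
Qed.

End Indices.

Section Triangles.
Context {K : realType}.
Implicit Types (T U : triangle K) (i j : 'I_3) (p q x y z : plane K) (s t : K).

Definition det T : K := cross (T 1 - T 0) (T 2 - T 0).

Lemma det_rot T i : side_of (T (ordS i)) (T (ord_pred i)) (T i) = det T.
Proof.
have e (n : 'I_3) : n = 0 -> T (ordS n) = T 1 /\ T (ord_pred n) = T 2.
  by move=> ->; split; congr (T _); apply: val_inj.
rewrite /side_of /det.
have [e0 e1] := e 0 erefl.
case: (ord3P 0 i) => ->.
- by rewrite e0 e1; coords; ring.
- by rewrite ordSS ordSK e0 e1; coords; ring.
- by rewrite ord_predK ord_predP e0 e1; coords; ring.
Qed.

Lemma areaE T : area T = `|det T| / 2.
Proof. by []. Qed.

Definition bary T i z : K := side_of (T (ordS i)) (T (ord_pred i)) z / det T.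

Lemma bary_vertex T i : nondegenerate T -> bary T i (T i) = 1.
Proof. by move=> nT; rewrite /bary det_rot divff. Qed.

Lemma bary_vertexS T i : bary T i (T (ordS i)) = 0.
Proof. by rewrite /bary /side_of; coords; rewrite !subrr !mulr0 subr0 mul0r. Qed.

Lemma bary_vertexP T i : bary T i (T (ord_pred i)) = 0.
Proof. by rewrite /bary /side_of; coords; rewrite [X in X / _](_ : _ = 0) ?mul0r //; ring. Qed.

Lemma bary_conv T i s x y :
  bary T i (s *: x + (1 - s) *: y) = s * bary T i x + (1 - s) * bary T i y.
Proof. by rewrite /bary /side_of; coords; ring. Qed.

Lemma bary_sum T z i : nondegenerate T ->
  bary T i z + bary T (ordS i) z + bary T (ord_pred i) z = 1.
Proof.
move=> nT; rewrite /bary -!mulrDl -[RHS](divff nT); congr (_ / _).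
rewrite -/(det T) -(det_rot T i) ordSK ordSS ord_predP ord_predK /side_of.
by coords; ring.
Qed.

Lemma bary_decomp T z : nondegenerate T -> z = \sum_i bary T i z *: T i.
Proof.
move=> nT; rewrite (sum3 0) /bary ordSK ordSS ord_predP ord_predK.
have nT' : det T != 0 := nT.
have := nT'; rewrite -{1}(det_rot T 0).
rewrite -(det_rot T 0) /side_of.
set p := T (ordS 0); set q := T (ord_pred 0); set x := T 0.
by coords => h; apply: plane_eqP; coords; field.
Qed.

Lemma convex_setE (C : set (plane K)) :
  convex_set (C : set (convex_lmodType (plane K))) <->
  forall x y s, 0 <= s <= 1 -> C x -> C y -> C (s *: x + (1 - s) *: y).
Proof.
split=> [cC x y s /andP[s0 s1] Cx Cy|h x y l].
  have := cC x y (Itv01 s0 s1); rewrite !inE => /(_ Cx Cy).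
  by [].
by rewrite !inE => Cx Cy; apply: h => //; rewrite ge0 le1.
Qed.

Lemma hull_sub (A C : set (plane K)) :
  (forall x y s, 0 <= s <= 1 -> C x -> C y -> C (s *: x + (1 - s) *: y)) ->
  A `<=` C -> hull A `<=` C.
Proof. by move=> /convex_setE cC AC z; apply; split. Qed.

Lemma sub_hull (A : set (plane K)) : A `<=` hull A.
Proof. by move=> x Ax C [_]; apply. Qed.

Lemma hull_conv (A : set (plane K)) x y s : 0 <= s <= 1 ->
  hull A x -> hull A y -> hull A (s *: x + (1 - s) *: y).
Proof.
move=> s01 hx hy C [cC AC]; move/convex_setE : (cC); apply => //; [exact: hx|exact: hy].
Qed.

Lemma hull_mono (A B : set (plane K)) : A `<=` B -> hull A `<=` hull B.
Proof. by move=> AB; apply: hull_sub => [x y s|x /AB /sub_hull //]; apply: hull_conv. Qed.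

Lemma hull_triangleP T z : nondegenerate T ->
  hull (vertices T) z <-> forall i, 0 <= bary T i z.
Proof.
move=> nT; split.
  apply: (hull_sub (C := [set z | forall i, 0 <= bary T i z])) => /= [x y s|x].
    move=> /andP[s0 s1] hx hy i; rewrite bary_conv.
    by rewrite addr_ge0 // mulr_ge0 // subr_ge0.
  move=> [j _ <-] i; case: (ord3P i j) => ->.
  - by rewrite bary_vertex.
  - by rewrite bary_vertexS.
  - by rewrite bary_vertexP.
move=> h.
have hv j : hull (vertices T) (T j) by apply: sub_hull; exists j.
have zE := bary_decomp z nT; rewrite (sum3 0) in zE; rewrite {}zE.
have := bary_sum z 0 nT.
move: (h 0) (h (ordS 0)) (h (ord_pred 0)).
move: (bary T 0 z) (bary T (ordS 0) z) (bary T (ord_pred 0) z) => a b c a0 b0 c0 abc.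
case: (eqVneq a 1) => a1.
  have -> : b = 0 by lra.
  have -> : c = 0 by lra.
  by rewrite a1 !scale0r !addr0 scale1r.
have a1' : 1 - a != 0 by rewrite subr_eq0 eq_sym.
have a1'' : 0 < 1 - a by rewrite lt_neqAle eq_sym a1' /=; lra.
rewrite -addrA (_ : b *: _ + _ = (1 - a) *:
    ((b / (1 - a)) *: T (ordS 0) + (1 - b / (1 - a)) *: T (ord_pred 0))).
  apply: hull_conv => //; first by apply/andP; split; lra.
  apply: hull_conv => //; rewrite divr_ge0 //= ?ler_pdivrMr //; lra.
rewrite scalerDr !scalerA; congr (_ *: _ + _ *: _); first by field.
by rewrite (_ : c = 1 - a - b); [field | lra].
Qed.

Lemma bary_continuous T i : continuous (bary T i).
Proof.
set p := T (ordS i); set q := T (ord_pred i).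
have -> : bary T i = (fun z : plane K => (p 0 1 - q 0 1) / det T * z 0 0) \+
    (fun z => (q 0 0 - p 0 0) / det T * z 0 1) \+ cst (bary T i 0).
  by apply/funext => z; rewrite /bary /side_of -/p -/q /=; coords; ring.
move=> z; apply: (cvgD (F := nbhs z)); last exact: (cvg_cst _ (F := nbhs z)).
by apply: (cvgD (F := nbhs z)); apply: (cvgMl_tmp (F := nbhs z));
  exact: coord_continuous.
Qed.

Lemma bary_interior T z : nondegenerate T ->
  (forall i, 0 < bary T i z) -> interior (hull (vertices T)) z.
Proof.
move=> nT h; change (nbhs z (hull (vertices T))).
have hn i : \forall w \near z, 0 < bary T i w.
  apply: (@bary_continuous T i z [set y | 0 < y]).
  by apply: open_nbhs_nbhs; split; [exact: open_gt | exact: h].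
apply: (filterS _ (filterI (hn 0) (filterI (hn (ordS 0)) (hn (ord_pred 0))))).
move=> w [h0 [h1 h2]]; apply/(hull_triangleP _ nT) => i; apply: ltW.
by case: (ord3P 0 i) => ->.
Qed.

(** Pushing a point of [U] towards the centroid of [U] makes it interior to [U]
    while a small push does not leave the open triangle [T]. *)
Lemma triangles_overlap T U z : nondegenerate T -> nondegenerate U ->
  (forall i, 0 < bary T i z) -> hull (vertices U) z ->
  interior (hull (vertices T)) `&` interior (hull (vertices U)) !=set0.
Proof.
move=> nT nU hz /(hull_triangleP _ nU) uz.
pose g : plane K := 3^-1 *: \sum_i U i.
have bg i : bary U i g = 3^-1.
  rewrite /bary -[RHS](mulfK (nU : det U != 0)); congr (_ / _).
  rewrite -(det_rot U i) /side_of /g (sum3 i); coords; by field.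
pose w s := s *: g + (1 - s) *: z.
pose m := Num.min (bary T 0 z) (Num.min (bary T (ordS 0) z) (bary T (ord_pred 0) z)).
have m0 : 0 < m by rewrite !lt_min !hz.
have mi i : m <= bary T i z.
  by case: (ord3P 0 i) => ->; rewrite !ge_min lexx ?orbT.
pose M := 1 + `|bary T 0 g| + `|bary T (ordS 0) g| + `|bary T (ord_pred 0) g|.
have Mi i : - bary T i g < M.
  have := (normr_ge0 (bary T 0 g)); have := (normr_ge0 (bary T (ordS 0) g)).
  have := (normr_ge0 (bary T (ord_pred 0) g)).
  have : - bary T i g <= `|bary T i g| by rewrite -normrN ler_norm.
  by rewrite /M; case: (ord3P 0 i) => ->; lra.
have M1 : 0 < M by rewrite /M -2!addrA ltr_pwDl // !addr_ge0.
pose s := m / (m + M).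
have s0 : 0 < s by rewrite divr_gt0 // addr_gt0.
have sE : s * (m + M) = m by rewrite /s divfK // gt_eqF // addr_gt0.
have s1 : s < 1.
  by rewrite -(ltr_pM2r (addr_gt0 m0 M1)) sE mul1r ltrDl.
exists (w s); split; apply: bary_interior => // i; rewrite bary_conv.
  have := mi i; have := Mi i; move: (bary T i g) (bary T i z) => a b ha hb.
  have : 0 < s * (a + M) by apply: mulr_gt0; lra.
  have : 0 <= (1 - s) * (b - m) by apply: mulr_ge0; lra.
  lra.
rewrite bg; have := uz i; move: (bary U i z) => b b0.
have : 0 <= (1 - s) * b by apply: mulr_ge0; lra.
lra.
Qed.

End Triangles.

(** * Finite sets and grid cells *)
Section Finiteness.

Lemma finite_injective (T : choiceType) (F : finType) (A : set T) (f : T -> F) :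
  (forall x y, A x -> A y -> f x = f y -> x = y) -> finite_set A.
Proof.
move=> finj; have [->|/set0P[x0 Ax0]] := eqVneq A set0; first exact: finite_set0.
pose g k := xget x0 [set x | A x /\ f x = k].
apply: (@sub_finite_set _ _ (g @` setT)); last exact/finite_image/finite_finset.
move=> x Ax; exists (f x) => //; rewrite /g.
have [] := @xgetPex _ x0 [set y | A y /\ f y = f x]; first by exists x.
by move=> Ay /finj; apply.
Qed.

Lemma size_injective (T : eqType) (F : finType) (s : seq T) (f : T -> F) :
  uniq s -> {in s &, injective f} -> (size s <= #|F|)%N.
Proof.
move=> us finj; rewrite -(size_map f) -(card_uniqP _); first exact: max_card.
by rewrite map_inj_in_uniq.
Qed.

Lemma finite_argmin (K : realType) (T : choiceType) (A : set T) (f : T -> K) :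
  finite_set A -> A !=set0 -> exists2 x, A x & forall y, A y -> f x <= f y.
Proof.
move=> /finite_seqP[s ->]; elim: s => [[x //]|a s IH _].
have [/IH[x xs hx]|s0] := pselect ([set` s] !=set0); last first.
  exists a => [|y /=]; first by rewrite /= mem_head.
  rewrite inE => /predU1P[-> //|ys]; case: s0; by exists y.
have [ax|xa] := leP (f a) (f x).
  exists a => [|y /=]; first by rewrite /= mem_head.
  by rewrite inE => /predU1P[-> //|ys]; apply: le_trans ax _; exact: hx.
exists x => [|y /=]; first by rewrite /= inE [x \in s]xs orbT.
by rewrite inE => /predU1P[->|ys]; [exact: ltW | exact: hx].
Qed.

(** Finitely many conditions that hold for all small enough arguments hold
    simultaneously for some argument. *)
Lemma finite_small (K : realType) (T : choiceType) (A : set T) (Q : T -> K -> Prop) :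
  finite_set A ->
  (forall a e e', Q a e -> 0 < e' <= e -> Q a e') ->
  (forall a, A a -> exists2 e, 0 < e & Q a e) ->
  exists2 e, 0 < e & forall a, A a -> Q a e.
Proof.
move=> /finite_seqP[s ->] Qm; elim: s => [_|a s IH h]; first by exists 1.
have [|e e0 he] := IH; first by move=> b bs; apply: h; rewrite /= inE [b \in s]bs orbT.
have [|e' e'0 he'] := h a; first by rewrite /= mem_head.
exists (Num.min e e'); first by rewrite lt_min e0.
move=> b /=; rewrite inE => /predU1P[->|bs].
  by apply: Qm he' _; rewrite lt_min e0 e'0 /= ge_min lexx orbT.
by apply: Qm (he _ bs) _; rewrite lt_min e0 e'0 /= ge_min lexx.
Qed.

End Finiteness.

Section Cells.
Context {K : realType} (r : K) (r0 : 0 < r).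
Implicit Types x y d : K.

Definition cell x : int := Num.floor (x / r).

Lemma cell_itv x : (cell x)%:~R * r <= x < (cell x)%:~R * r + r.
Proof.
have /andP[h1 h2] := floor_itv (x / r).
rewrite -ler_pdivlMr // h1 /=.
by rewrite -[X in _ + X]mul1r -mulrDl -ltr_pdivrMr // -[1]/(1%:~R) -intrD.
Qed.

Lemma cell_close x y : cell x = cell y -> `|x - y| < r.
Proof.
move=> h; have := cell_itv x; have := cell_itv y; rewrite h.
by move=> /andP[a b] /andP[c d]; rewrite ltr_norml; apply/andP; split; lra.
Qed.

Definition modulus d : nat := (Num.truncn (d / r)).+1.
(** The number of a cell is kept modulo an integer exceeding the difference of the
    numbers of the cells of two points at distance at most [d]: this distinguishes
    such cells without reference to their position. *)
Definition residue d x : 'I_(modulus d).+1 :=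
  inord `|(cell x %% (modulus d).+1)%Z|.

Lemma residue_inj d x y : `|x - y| <= d -> residue d x = residue d y ->
  cell x = cell y.
Proof.
move=> xyd; rewrite /residue; set N := (modulus d).+1 => /(congr1 val) /=.
have N0 : N%:Z != 0 by [].
have hlt z : (`|(z %% N)%Z| < N)%N.
  by rewrite -ltz_nat gez0_abs ?modz_ge0 // ltz_pmod.
rewrite !inordK // => /(congr1 Posz); rewrite !gez0_abs ?modz_ge0 // => /eqP.
rewrite eqz_mod_dvd => h.
apply/eqP; rewrite -subr_eq0; apply: contraTT h => ne.
apply/negP => /dvdzP [k hk].
have k0 : (1 <= `|k|)%R.
  by rewrite -gtz0_ge1 normr_gt0; apply: contraNneq ne => k0; rewrite hk k0 mul0r.
have : N%:Z <= `|cell x - cell y| by rewrite hk normrM ler_peMl.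
rewrite -(ler_int K) intr_norm intrB => hN.
have /andP[a b] := cell_itv x; have /andP[c e] := cell_itv y.
have : `|(cell x)%:~R - (cell y)%:~R| * r < d + r :> K.
  rewrite -[X in _ * X](gtr0_norm r0) -normrM ltr_norml.
  by move: xyd; rewrite ler_norml => /andP[]; move=> ??; apply/andP; split; lra.
rewrite -ltr_pdivlMr // => /(le_lt_trans hN).
rewrite mulrDl divff ?gt_eqF // ltNge => /negP; apply.
have := truncnS_gt (d / r); rewrite /N /modulus -pmulrn -[_.+2]addn1 natrD.
lra.
Qed.

End Cells.

(** * Empty circles of an (r,R)-system *)
Section Systems.
Context {K : realType} (r R : K) (P : set (plane K)).
Hypothesis hP : rR_system r R P.
Implicit Types (p q x y z c : plane K) (V : set (plane K)) (s t : K).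

Lemma packing_radius_gt0 : 0 < r. Proof. by case: hP. Qed.
Lemma covering_radius_gt0 : 0 < R.
Proof. by case: hP => r0 rR _ _; apply: lt_trans rR. Qed.

Lemma packing_dist p q : P p -> P q -> p <> q -> 4 * r ^+ 2 <= sqd p q.
Proof.
case: hP => r0 _ hd _ Pp Pq pq; rewrite leNgt; apply/negP => h.
have : (open_disc p r `&` open_disc q r) (2^-1 *: (p + q)).
  rewrite /open_disc /=; split; rewrite edist_lt ?(ltW r0) //.
    by move: h; rewrite /sqd; coords => h; lra.
  by move: h; rewrite /sqd; coords => h; lra.
by rewrite hd.
Qed.

Lemma covering_point c : exists2 p, P p & sqd c p <= R ^+ 2.
Proof.
case: hP => _ _ _ hc; have : setT c by [].
rewrite -hc => -[p Pp] /=; rewrite /disc /= edist_le ?(ltW covering_radius_gt0) // sqdC.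
by move=> h; exists p.
Qed.

Lemma coord_le_sqd x y d : 0 <= d -> sqd x y <= d ^+ 2 ->
  `|x 0 0 - y 0 0| <= d /\ `|x 0 1 - y 0 1| <= d.
Proof.
move=> d0; rewrite /sqd; coords => h.
have := sqr_ge0 (x 0 0 - y 0 0); have := sqr_ge0 (x 0 1 - y 0 1).
by split; apply: le_of_sqr_le => //; rewrite real_normK ?num_real //; lra.
Qed.

(** A square cell of side [r] has diameter [sqrt 2 * r], less than the minimal
    distance [2 r]. *)
Lemma cell_inj p q : P p -> P q ->
  cell r (p 0 0) = cell r (q 0 0) -> cell r (p 0 1) = cell r (q 0 1) -> p = q.
Proof.
move=> Pp Pq /(cell_close packing_radius_gt0) h0 /(cell_close packing_radius_gt0) h1.
apply: contrapT => pq; have := packing_dist Pp Pq pq.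
move: h0 h1; rewrite !ltr_norml => /andP[a b] /andP[c d].
rewrite /sqd; coords; nra.
Qed.

Lemma finite_disc c s : finite_set (P `&` [set x | sqd c x <= s]).
Proof.
pose d := 1 + `|s|; have d0 : 0 <= d by rewrite addr_ge0.
have sd : s <= d ^+ 2 by rewrite /d; have := ler_norm s; have := normr_ge0 s; nra.
pose key x := (residue r (2 * d) (x 0 0), residue r (2 * d) (x 0 1)).
apply: (finite_injective (f := key)) => x y [Px /= xs] [Py /= ys] [].
have [x0 x1] := coord_le_sqd d0 (le_trans xs sd).
have [y0 y1] := coord_le_sqd d0 (le_trans ys sd).
move: x0 x1 y0 y1; rewrite !ler_norml => /andP[? ?] /andP[? ?] /andP[? ?] /andP[? ?].
move=> /(residue_inj packing_radius_gt0) h0 /(residue_inj packing_radius_gt0) h1.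
apply: cell_inj => //; [apply: h0 | apply: h1];
  rewrite ler_norml; apply/andP; split; lra.
Qed.

Definition empty_pencil p q t := forall x, P x -> t * side_of p q x <= power p q x.

(** The points on the positive side of [p q] that lie in the disc of the pencil
    through one of them, [x0], are finite in number; the smallest parameter among
    them is that of the first circle met.  On the negative side, the discs
    decrease as the parameter increases, so that they stay empty. *)
Lemma pencil_grow p q t : P p -> P q -> p <> q -> empty_pencil p q t ->
  exists x t', [/\ P x, 0 < side_of p q x, t <= t',
    power p q x = t' * side_of p q x & empty_pencil p q t'].
Proof.
move=> Pp Pq pq he; have r0 := packing_radius_gt0.
have rR : r < R by case: hP.
have pq4 := packing_dist Pp Pq pq.
have [x0 Px0 sx0] : exists2 x, P x & 0 < side_of p q x.
  (* [n] is [q - p] turned by a right angle, and the factor [R / r] moves [p] by at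
     least [2 R], away from the line [p q] by more than the covering radius *)
  pose n : plane K := \row_j (if j == 0 then - (q 0 1 - p 0 1) else q 0 0 - p 0 0).
  pose l := R / r.
  have lr : l * r = R by rewrite /l divfK // gt_eqF.
  have l0 : 0 < l by rewrite divr_gt0 // (lt_trans r0).
  have [x Px hx] := covering_point (p + l *: n); exists x => //.
  set e := x - (p + l *: n).
  have -> : side_of p q x = l * sqd p q + cross (q - p) e.
    by rewrite /side_of /sqd /e /n; coords => /=; ring.
  have he2 : dot e e <= R ^+ 2 by [].
  have hc : cross (q - p) e ^+ 2 <= sqd p q * R ^+ 2.
    have -> : cross (q - p) e ^+ 2 = sqd p q * dot e e - dot (q - p) e ^+ 2.
      by rewrite /sqd; coords; ring.
    have := sqr_ge0 (dot (q - p) e); have := ler_wpM2l (sqd_ge0 p q) he2.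
    lra.
  have hlt : cross (q - p) e ^+ 2 < (l * sqd p q) ^+ 2.
    apply: le_lt_trans hc _; rewrite -lr.
    have r2 : 0 < r ^+ 2 by rewrite exprn_gt0.
    have -> : (l * sqd p q) ^+ 2 = sqd p q * (l ^+ 2 * sqd p q) by ring.
    rewrite exprMn ltr_pM2l; last by lra.
    by rewrite ltr_pM2l ?exprn_gt0 //; lra.
  have lp : 0 < l * sqd p q by rewrite mulr_gt0 // sqd_gt0.
  rewrite ltNge; apply/negP => h.
  have : 0 <= (- cross (q - p) e - l * sqd p q) * (l * sqd p q - cross (q - p) e).
    by apply: mulr_ge0; lra.
  lra.
pose t0 := power p q x0 / side_of p q x0.
have [c0 hc0] := pencil_center p q t0.
pose A := P `&` [set y | 0 < side_of p q y /\ power p q y <= t0 * side_of p q y].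
have fA : finite_set A.
  apply: sub_finite_set (finite_disc c0 (sqd c0 p)) => y [Py [_ hy]]; split=> //=.
  by have := hc0 y; lra.
have A0 : A !=set0 by exists x0; split=> //; split=> //; rewrite /t0 divfK // gt_eqF.
have [x [Px [sx hx]] xmin] := finite_argmin (fun y => power p q y / side_of p q y) fA A0.
set t' := power p q x / side_of p q x in xmin.
have xE : power p q x = t' * side_of p q x by rewrite /t' divfK // gt_eqF.
have t't0 : t' <= t0 by move: hx; rewrite xE ler_pM2r.
have tt' : t <= t' by have := he x Px; rewrite xE ler_pM2r.
exists x, t'; split=> // y Py.
have [sy|sy] := leP (side_of p q y) 0.
  by apply: le_trans (he y Py); rewrite ler_wnM2r.
have [hy|hy] := leP (power p q y) (t0 * side_of p q y).
  by rewrite -ler_pdivlMr //; apply: xmin.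
by apply: le_trans (ltW hy); rewrite ler_pM2r.
Qed.

Lemma delone_circle V : delone_vertices P V -> exists c Q,
  [/\ 0 <= Q <= R ^+ 2, forall x, P x -> Q <= sqd c x
    & forall x, V x <-> P x /\ sqd c x = Q].
Proof.
move=> [c [s [he -> [x [y [z [[Px cx] _ _ _]]]]]]].
have s0 : 0 <= s by rewrite -cx edist_ge0.
have hs y' : P y' -> s ^+ 2 <= sqd c y'.
  move=> Py; rewrite leNgt -edist_lt //; apply/negP => h.
  by have : (P `&` open_disc c s) y' by []; rewrite he.
exists c, (s ^+ 2); split=> //.
  rewrite sqr_ge0 /=; have [p Pp hp] := covering_point c.
  exact: le_trans (hs p Pp) hp.
by move=> w; split=> -[Pw cw]; split=> //; apply/edist_eq.
Qed.

Lemma delone_of_pencil p q x t : P p -> P q -> P x -> side_of p q x <> 0 ->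
  power p q x = t * side_of p q x -> empty_pencil p q t ->
  delone_vertices P [set y | P y /\ power p q y = t * side_of p q y].
Proof.
move=> Pp Pq Px sx hx he; have [c hc] := pencil_center p q t.
have s0 := edist_ge0 c p.
exists c, (edist c p); split.
- rewrite -subset0 => y [Py]; rewrite /open_disc /= edist_lt // edist_sqr.
  by have := he y Py; have := hc y; lra.
- apply/seteqP; split=> y [Py hy]; split=> //.
    by apply/edist_eq => //; rewrite edist_sqr; have := hc y; lra.
  by move/edist_eq : hy => /(_ s0); rewrite edist_sqr; have := hc y; lra.
- exists p, q, x; split=> //=.
  + by split=> //; rewrite /power /side_of; coords; ring.
  + by split=> //; rewrite /power /side_of; coords; ring.
  + by apply/eqP.
Qed.

Lemma on_circle_line p q x : p <> q -> power p q x = 0 -> side_of p q x = 0 ->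
  x = p \/ x = q.
Proof.
move=> pq; rewrite /power /side_of => h0 h1.
have d0 := sqd_gt0 pq.
have : sqd p q * sqd p x * (sqd q x) = 0.
  have -> : sqd p q * sqd p x = cross (q - p) (x - p) ^+ 2 + dot (q - p) (x - p) ^+ 2.
    by rewrite /sqd; coords; ring.
  rewrite h1 expr0n /= add0r.
  have -> : dot (q - p) (x - p) ^+ 2 * sqd q x =
     (sqd q x) * (sqd p x - dot (x - p) (x - q)) ^+ 2 by rewrite /sqd; coords; ring.
  rewrite h0 subr0.
  have -> : sqd q x * sqd p x ^+ 2 =
      sqd p x * (dot (x - p) (x - q) ^+ 2 + cross (q - p) (x - p) ^+ 2).
    by rewrite /sqd; coords; ring.
  by rewrite h0 h1 expr0n /= addr0 mulr0.
move=> /eqP; rewrite !mulf_eq0 gt_eqF //= => /orP[] /eqP h.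
  by left; apply: contrapT => xp; have := sqd_gt0 (nesym xp); rewrite h ltxx.
by right; apply: contrapT => xp; have := sqd_gt0 (nesym xp); rewrite h ltxx.
Qed.

End Systems.

(** * Triangles across an edge *)
Section Edges.
Context {K : realType}.
Implicit Types (T U : triangle K) (i j : 'I_3) (p q x y z : plane K) (s t : K).

Definition midpoint p q : plane K := 2^-1 *: p + (1 - 2^-1) *: q.

Lemma half_itv : 0 <= (2^-1 : K) <= 1.
Proof. by apply/andP; split; lra. Qed.

Lemma bary_midpointS T i : nondegenerate T ->
  bary T (ordS i) (midpoint (T (ordS i)) (T (ord_pred i))) = 2^-1.
Proof.
move=> nT; rewrite bary_conv bary_vertex // -ordSS bary_vertexS.
by rewrite mulr1 mulr0 addr0.
Qed.

Lemma bary_midpointP T i : nondegenerate T ->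
  bary T (ord_pred i) (midpoint (T (ordS i)) (T (ord_pred i))) = 2^-1.
Proof.
move=> nT; rewrite bary_conv bary_vertex // -ord_predP bary_vertexP.
by rewrite mulr0 mulr1 add0r; lra.
Qed.

Lemma bary_midpoint0 T i :
  bary T i (midpoint (T (ordS i)) (T (ord_pred i))) = 0.
Proof. by rewrite bary_conv bary_vertexS bary_vertexP !mulr0 addr0. Qed.

(** Near the midpoint of a side, the triangle fills its half-plane. *)
Lemma edge_interior T i y : nondegenerate T -> 0 < bary T i y ->
  exists2 s, 0 < s <= 1 &
    forall k, 0 < bary T k (s *: y + (1 - s) *: midpoint (T (ordS i)) (T (ord_pred i))).
Proof.
move=> nT y0; set b1 := bary T (ordS i) y; set b2 := bary T (ord_pred i) y.
have n1 := normr_ge0 b1; have n2 := normr_ge0 b2.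
pose s := (2 + 2 * `|b1| + 2 * `|b2|)^-1.
have d0 : 0 < 2 + 2 * `|b1| + 2 * `|b2| by lra.
have s0 : 0 < s by rewrite invr_gt0.
have sE : s * (2 + 2 * `|b1| + 2 * `|b2|) = 1 by rewrite mulVf // gt_eqF.
have sb1 : 0 <= s * `|b1| by rewrite mulr_ge0 // ltW.
have sb2 : 0 <= s * `|b2| by rewrite mulr_ge0 // ltW.
have h b : - (s * `|b|) <= s * b.
  by rewrite -mulrN ler_pM2l // lerNl -normrN ler_norm.
exists s; first by rewrite s0 /=; lra.
move=> k; rewrite bary_conv; case: (ord3P i k) => ->.
- by rewrite bary_midpoint0 mulr0 addr0 mulr_gt0.
- by rewrite bary_midpointS // -/b1; have := h b1; lra.
- by rewrite bary_midpointP // -/b2; have := h b2; lra.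
Qed.

Lemma side_of_bary T i z : nondegenerate T ->
  side_of (T (ordS i)) (T (ord_pred i)) z = det T * bary T i z.
Proof. by move=> nT; rewrite /bary mulrC divfK. Qed.

Lemma side_ofC p q z : side_of q p z = - side_of p q z.
Proof. by rewrite /side_of; coords; ring. Qed.

Lemma powerC p q z : power q p z = power p q z.
Proof. by rewrite /power; coords; ring. Qed.

Lemma side_of_conv p q s x y :
  side_of p q (s *: x + (1 - s) *: y) = s * side_of p q x + (1 - s) * side_of p q y.
Proof. by rewrite /side_of; coords; ring. Qed.

Lemma side_of_midpoint p q : side_of p q (midpoint p q) = 0.
Proof. by rewrite /side_of /midpoint; coords; field. Qed.

Lemma midpointC p q : midpoint q p = midpoint p q.
Proof. by apply: plane_eqP; rewrite /midpoint; coords; field. Qed.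

Lemma hull_midpoint (A : set (plane K)) p q : A p -> A q -> hull A (midpoint p q).
Proof. by move=> Ap Aq; apply: hull_conv half_itv _ _; exact: sub_hull. Qed.

Lemma midpoint_neq p q : p <> q -> midpoint p q <> p.
Proof.
move=> pq h; apply: pq; have := congr1 (fun v : plane K => v 0 0) h.
have := congr1 (fun v : plane K => v 0 1) h; rewrite /midpoint; coords => h1 h0.
by apply: plane_eqP; lra.
Qed.

Lemma vertex_inj T : nondegenerate T -> injective T.
Proof.
move=> nT i j h; case: (ord3P i j) => // jE; have := bary_vertex i nT;
  rewrite h jE ?bary_vertexS ?bary_vertexP => /eqP; rewrite eq_sym oner_eq0 //.
Qed.

Lemma side_of_decomp T p q z : nondegenerate T ->
  side_of p q z = \sum_i bary T i z * side_of p q (T i).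
Proof.
move=> nT; rewrite [in LHS](bary_decomp z nT) !(sum3 0).
move: (bary_sum z 0 nT); move: (bary T 0 z) (bary T (ordS 0) z) (bary T (ord_pred 0) z) => a b c h.
have -> : a = 1 - b - c by lra.
rewrite /side_of; coords. ring.
Qed.

End Edges.

Section Triangulation.
Context {K : realType} (r R : K) (P : set (plane K)) (TT : set (triangle K)).
Hypothesis hP : rR_system r R P.
Hypothesis hT : delone_triangulation P TT.
Implicit Types (T U : triangle K) (i j : 'I_3) (p q x y z : plane K) (s t : K).

Lemma triangle_circle T : TT T -> exists V c Q,
  [/\ delone_vertices P V, vertices T `<=` V,
   0 <= Q <= R ^+ 2, forall x, P x -> Q <= sqd c x
    & forall x, V x <-> P x /\ sqd c x = Q].
Proof.
move=> TT_T; have [V dV TV] := hT.1 T TT_T.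
by have [c [Q [h1 h2 h3]]] := delone_circle hP dV; exists V, c, Q.
Qed.

Lemma triangle_nondegenerate T : TT T -> nondegenerate T.
Proof.
move=> TT_T; have [V dV TV] := hT.1 T TT_T.
by have [h _ _] := hT.2 V dV; have [] := h T (conj TT_T TV).
Qed.

Lemma triangle_vertex T i : TT T -> P (T i).
Proof.
by move=> /triangle_circle[V [c [Q [_ TV _ _ h]]]]; have /h[] : V (T i) by apply: TV; exists i.
Qed.

Lemma triangle_pencil T p q : TT T -> vertices T p -> vertices T q -> p <> q ->
  exists V t, [/\ delone_vertices P V, vertices T `<=` V, empty_pencil P p q t
    & forall x, V x <-> P x /\ power p q x = t * side_of p q x].
Proof.
move=> TT_T Tp Tq pq; have [V [c [Q [dV TV _ he hV]]]] := triangle_circle TT_T.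
have /hV[_ cp] : V p by apply: TV.
have /hV[_ cq] : V q by apply: TV.
have [|t ht] := pencil_param (c := c) pq; first by rewrite cp cq.
exists V, t; split=> // [x Px|x].
  by have := he x Px; have := ht x; rewrite cp; lra.
rewrite hV; split=> -[Px hx]; split=> //; have := ht x; rewrite cp; lra.
Qed.

Lemma no_overlap V T U z : delone_vertices P V -> TT T -> TT U -> T <> U ->
  vertices T `<=` V -> vertices U `<=` V ->
  (forall i, 0 < bary T i z) -> ~ hull (vertices U) z.
Proof.
move=> dV TT_T TT_U TU TV UV hz Uz; have [_ h _] := hT.2 V dV.
have := triangles_overlap (triangle_nondegenerate TT_T) (triangle_nondegenerate TT_U) hz Uz.
by rewrite (h T U (conj TT_T TV) (conj TT_U UV) TU) => /set0P; rewrite eqxx.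
Qed.

(** A triangle [T] of the next Delone polygon covers points tending to the midpoint
    [m] of [p q], and contains [m] itself.  If [T] has a vertex on the negative side, then
    the circle has not moved, [T] and [U] belong to the same polygon, and they
    overlap near [m].  Otherwise only vertices of [T] on the line [p q], that is
    [p] and [q], contribute to [m]. *)
Lemma across_edge_oriented U i p q : TT U -> P p -> P q -> p <> q ->
  [set p; q] = side U i ->
  (forall z, side_of p q z = - `|det U| * bary U i z) ->
  exists T j, [/\ TT T, side T j = side U i & 0 < side_of p q (T j)].
Proof.
move=> TT_U Pp Pq pq UiE sU; have nU := triangle_nondegenerate TT_U.
have det0 : 0 < `|det U| by rewrite normr_gt0.
have Uv z : [set p; q] z -> vertices U z.
  by rewrite UiE => -[] ->; [exists (ordS i) | exists (ord_pred i)].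
have Up : vertices U p by apply: Uv; left.
have Uq : vertices U q by apply: Uv; right.
have [V0 [t [dV0 UV0 et hV0]]] := triangle_pencil TT_U Up Uq pq.
have [x [t' [Px sx tt' xE et']]] := pencil_grow hP Pp Pq pq et.
pose V := [set y | P y /\ power p q y = t' * side_of p q y].
have dV : delone_vertices P V.
  by apply: (delone_of_pencil Pp Pq Px) => //; apply/eqP; rewrite gt_eqF.
have Vp : V p by split=> //; rewrite /power /side_of; coords; ring.
have Vq : V q by split=> //; rewrite /power /side_of; coords; ring.
have Vx : V x by [].
have [hnd hdis hcov] := hT.2 V dV.
set A := TT `&` _ in hnd hdis hcov.
have finV : finite_set V.
  have [c [Q [_ _ hV]]] := delone_circle hP dV.
  by apply: sub_finite_set (finite_disc hP c Q) => y /hV[Py cy]; split=> //=; rewrite cy.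
have finA : finite_set A.
  pose B := [set [ffun i : 'I_3 => if i == 0 then ab.1 else if i == 1 then ab.2 else c]
             | ab in V `*` V & c in V].
  apply: (@sub_finite_set _ _ B); last first.
    by apply: finite_image2 => //; exact: finite_setX.
  move=> T [_ /= TV]; exists (T 0, T 1); first by split; apply: TV; eexists.
  exists (T 2); first by apply: TV; eexists.
  apply/ffunP => k; rewrite ffunE; case: ifPn => [/eqP -> //|k0].
  case: ifPn => [/eqP -> //|k1]; congr (T _); apply/val_inj.
  by case: k k0 k1 => [[|[|[|//]]] hk].
pose m := midpoint p q; pose w s : plane K := s *: x + (1 - s) *: m.
have Vm : hull V m by exact: hull_midpoint.
have sw s : side_of p q (w s) = s * side_of p q x.
  by rewrite side_of_conv side_of_midpoint mulr0 addr0.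
have [T [TA hTw]] : exists T, A T /\ forall e, 0 < e ->
    exists s, 0 < s <= e /\ hull (vertices T) (w s).
  apply: contrapT => hno.
  have [e e0 he] : exists2 e, 0 < e & forall T, A T ->
      forall s, 0 < s <= e -> ~ hull (vertices T) (w s).
    pose Q T e := forall s, 0 < s <= e -> ~ hull (vertices T) (w s).
    apply: (finite_small (Q := Q) finA).
      move=> T e e' h /andP[_ e'e] s /andP[s0 se']; apply: h.
      by rewrite s0 (le_trans se').
    move=> T AT; apply: contrapT => hnoT; apply: hno; exists T; split=> // e e0.
    apply: contrapT => hnos; apply: hnoT; exists e => // s s01 hs; apply: hnos.
    by exists s.
  pose s := Num.min e 1.
  have s01 : 0 < s <= 1 by rewrite lt_min e0 ltr01 ge_min lexx orbT.
  have : hull V (w s).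
    apply: hull_conv => //; last exact: sub_hull.
    by case/andP: s01 => /ltW -> ->.
  rewrite -hcov => -[T TA]; apply: he => //.
  by case/andP: s01 => -> _ /=; rewrite ge_min lexx.
have [TT_T TV] := TA; rewrite /= in TV.
have nT := triangle_nondegenerate TT_T.
have TVk k : V (T k) by apply: TV; exists k.
have Tm : hull (vertices T) m.
  apply/hull_triangleP => // k; rewrite leNgt; apply/negP => k0.
  have [e e0 he] : exists2 e, 0 < e & forall s, 0 < s <= e -> bary T k (w s) < 0.
    set a := bary T k x; set b := bary T k m in k0.
    have a0 := normr_ge0 a; have d0 : 0 < 1 + `|a| - b by lra.
    exists (- b / (1 + `|a| - b)); first by rewrite divr_gt0 // oppr_gt0.
    move=> s /andP[s0]; rewrite ler_pdivlMr // => hs.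
    rewrite bary_conv -/a -/b.
    have : s * a <= s * `|a| by rewrite ler_pM2l // ler_norm.
    lra.
  have [s [hs /(hull_triangleP _ nT)/(_ k)]] := hTw e e0.
  by rewrite leNgt he.
have [s [/andP[s0 _] Tw]] := hTw 1 ltr01.
have Twb := (hull_triangleP _ nT).1 Tw.
have [j sj] : exists j, 0 < side_of p q (T j).
  apply: contrapT => hno; have : 0 < side_of p q (w s) by rewrite sw mulr_gt0.
  rewrite (side_of_decomp _ _ _ nT) ltNge => /negP; apply; apply: sumr_le0 => k _.
  by rewrite mulr_ge0_le0 // leNgt; apply/negP => hk; apply: hno; exists k.
have TU : T <> U.
  move=> TUE; rewrite TUE in sj; move: sj; rewrite sU.
  suff : 0 <= bary U i (U j) by nra.
  by apply: (hull_triangleP _ nU).1; apply: sub_hull; exists j.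
exists T, j; split=> //.
have side0 k : 0 <= side_of p q (T k).
  rewrite leNgt; apply/negP => sk.
  have [PTk hTk] := TVk k.
  have tE : t' = t.
    apply/eqP; rewrite eq_le tt' andbT; have := et _ PTk.
    by rewrite hTk ler_nM2r.
  have UV : vertices U `<=` V by move=> y /UV0/hV0; rewrite -tE.
  have bk : 0 < bary U i (T k).
    by move: sk; rewrite sU mulNr oppr_lt0 pmulr_rgt0.
  have [e /andP[e0 e1] he] := edge_interior nU bk.
  apply: (no_overlap dV TT_U TT_T (nesym TU) UV TV he).
  have -> : midpoint (U (ordS i)) (U (ord_pred i)) = m.
    have [pE|pE] : side U i p by rewrite -UiE; left.
      have [qE|qE] : side U i q by rewrite -UiE; right.
        by case: pq; rewrite pE.
      by rewrite -pE -qE.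
    have [qE|qE] : side U i q by rewrite -UiE; right.
      by rewrite -pE -qE midpointC.
    by case: pq; rewrite pE.
  by apply: hull_conv => //; [rewrite (ltW e0) | apply: sub_hull; exists k].
have Tmb := (hull_triangleP _ nT).1 Tm.
have onpq k : 0 < bary T k m -> T k = p \/ T k = q.
  move=> k0; have [PTk hTk] := TVk k.
  have sk : side_of p q (T k) = 0.
    have : side_of p q m = 0 by exact: side_of_midpoint.
    rewrite (side_of_decomp _ _ _ nT) => /eqP; rewrite psumr_eq0; last first.
      by move=> l _; apply: mulr_ge0.
    by move=> /allP/(_ k); rewrite mem_index_enum mulf_eq0 (gt_eqF k0) => /(_ isT)/eqP.
  by apply: on_circle_line => //; rewrite hTk sk mulr0.
have bj : bary T j m = 0.
  apply/eqP; rewrite eq_le Tmb andbT leNgt; apply/negP => /onpq.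
  by case=> jE; move: sj; rewrite jE /side_of; coords; rewrite (_ : _ - _ = 0) ?ltxx //; ring.
have bsum := bary_sum m j nT.
have mE : m = bary T (ordS j) m *: T (ordS j) + bary T (ord_pred j) m *: T (ord_pred j).
  by rewrite {1}(bary_decomp m nT) (sum3 j) bj scale0r add0r.
have npq : m <> p /\ m <> q.
  by split; [exact: midpoint_neq | rewrite /m -midpointC; apply: midpoint_neq; exact: nesym].
have b1 : 0 < bary T (ordS j) m.
  rewrite lt_neqAle Tmb andbT; apply/eqP => h.
  have b2 : bary T (ord_pred j) m = 1 by lra.
  have [] := onpq (ord_pred j); rewrite ?b2 // => h2;
    move: mE; rewrite -h b2 scale0r add0r scale1r h2.
    by case: npq.
  by case: npq.
have b2 : 0 < bary T (ord_pred j) m.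
  rewrite lt_neqAle Tmb andbT; apply/eqP => h.
  have b2 : bary T (ordS j) m = 1 by lra.
  have [] := onpq (ordS j); rewrite ?b2 // => h2;
    move: mE; rewrite -h b2 scale0r addr0 scale1r h2.
    by case: npq.
  by case: npq.
rewrite -UiE /side.
have ne : T (ordS j) <> T (ord_pred j).
  by move=> /(vertex_inj nT)/eqP; rewrite -ordSS eq_sym (negbTE (ordS_neq _)).
case: (onpq _ b1) => h1; case: (onpq _ b2) => h2; rewrite h1 h2 // in ne *.
by rewrite setUC.
Qed.

End Triangulation.

Section Neighbours.
Context {K : realType}.
Implicit Types (T U : triangle K) (i j : 'I_3) (p q x y z : plane K) (s t : K).

Lemma ordS_neq_pred i : ordS i != ord_pred i.
Proof. by rewrite -ordSS eq_sym ordS_neq. Qed.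

Lemma edge_neq T i : nondegenerate T -> T (ordS i) <> T (ord_pred i).
Proof. by move=> nT /(vertex_inj nT)/eqP; rewrite (negbTE (ordS_neq_pred i)). Qed.

Lemma side_eqP T U i j : nondegenerate T -> side T j = side U i ->
  (T (ordS j) = U (ordS i) /\ T (ord_pred j) = U (ord_pred i)) \/
  (T (ordS j) = U (ord_pred i) /\ T (ord_pred j) = U (ordS i)).
Proof.
move=> nT h; have ne := @edge_neq T j nT.
have [h1|h1] : side U i (T (ordS j)) by rewrite -h; left.
  have [h2|h2] : side U i (T (ord_pred j)) by rewrite -h; right.
    by case: ne; rewrite h1.
  by left.
have [h2|h2] : side U i (T (ord_pred j)) by rewrite -h; right.
  by right.
by case: ne; rewrite h1.
Qed.

Lemma side_inj T i j : nondegenerate T -> side T i = side T j -> i = j.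
Proof.
move=> nT h; suff hj : ~ side T j (T j).
  case: (ord3P j i) => // iE; case: hj; rewrite -h iE /side ?ordSK ?ord_predK.
    by right.
  by left.
case=> /(vertex_inj nT)/eqP; rewrite eq_sym.
  by rewrite (negbTE (ordS_neq _)).
by rewrite (negbTE (ord_pred_neq _)).
Qed.

Definition opposite U i T j :=
  side_of (U (ordS i)) (U (ord_pred i)) (U i) *
  side_of (U (ordS i)) (U (ord_pred i)) (T j) < 0.

Variables (r R : K) (P : set (plane K)) (TT : set (triangle K)).
Hypothesis hP : rR_system r R P.
Hypothesis hT : delone_triangulation P TT.

Let ndg := triangle_nondegenerate hT.

(** The previous lemma wants [U] on the negative side of the edge, which settles in
    which order the end points are taken. *)
Lemma across_edge U i : TT U ->
  exists T j, [/\ TT T, side T j = side U i & opposite U i T j].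
Proof.
move=> TT_U; have nU := ndg TT_U.
have Pp := triangle_vertex hP hT (ordS i) TT_U.
have Pq := triangle_vertex hP hT (ord_pred i) TT_U.
have pq := @edge_neq U i nU.
have sE z := side_of_bary i z nU.
rewrite /opposite sE bary_vertex // mulr1.
have [d0|d0] := ltP (det U) 0.
  have [] // := across_edge_oriented hP hT (i := i) TT_U Pp Pq pq.
    by move=> z; rewrite sE ltr0_norm // opprK.
  move=> T [j [TT_T TE sT]]; exists T, j; split=> //.
  by rewrite nmulr_rlt0.
have d1 : 0 < det U by rewrite lt_neqAle eq_sym nU.
have [] := across_edge_oriented hP hT (i := i) TT_U Pq Pp (nesym pq).
- by rewrite setUC.
- by move=> z; rewrite side_ofC sE gtr0_norm // mulNr.
move=> T [j [TT_T TE sT]]; exists T, j; split=> //.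
by rewrite pmulr_rlt0 // -oppr_gt0 -side_ofC.
Qed.

(** Two triangles on the same side of a common edge lie in the same circle of
    the pencil through the end points of the edge, since the apex of neither is
    inside the circle of the other. *)
Lemma edge_unique U T i j : TT U -> TT T -> side T j = side U i ->
  0 < side_of (U (ordS i)) (U (ord_pred i)) (U i) *
      side_of (U (ordS i)) (U (ord_pred i)) (T j) -> U = T.
Proof.
move=> TT_U TT_T TE; have nU := ndg TT_U; have nT := ndg TT_T.
have pq := @edge_neq U i nU.
set p := U (ordS i) in pq *; set q := U (ord_pred i) in pq * => sUT.
have Up : vertices U p by exists (ordS i).
have Uq : vertices U q by exists (ord_pred i).
have [Tp Tq] : vertices T p /\ vertices T q.
  case: (side_eqP nT TE) => -[h3 h4]; first by split; [exists (ordS j) | exists (ord_pred j)].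
  by split; [exists (ord_pred j) | exists (ordS j)].
have [V1 [t1 [dV1 UV1 e1 hV1]]] := triangle_pencil hP hT TT_U Up Uq pq.
have [V2 [t2 [dV2 UV2 e2 hV2]]] := triangle_pencil hP hT TT_T Tp Tq pq.
have /hV1[PU pU] : V1 (U i) by apply: UV1; exists i.
have /hV2[PT pT] : V2 (T j) by apply: UV2; exists j.
have h1 := e2 _ PU; rewrite pU in h1.
have h2 := e1 _ PT; rewrite pT in h2.
have tE : t1 = t2.
  set a := side_of p q (U i) in h1 sUT; set b := side_of p q (T j) in h2 sUT.
  have : 0 <= ((t1 - t2) * a) * ((t2 - t1) * b) by apply: mulr_ge0; lra.
  have -> : (t1 - t2) * a * ((t2 - t1) * b) = - ((t1 - t2) ^+ 2 * (a * b)) by ring.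
  rewrite oppr_ge0 pmulr_lle0 // => h.
  by apply/eqP; rewrite -subr_eq0 -sqrf_eq0 eq_le h sqr_ge0.
have TV1 : vertices T `<=` V1 by move=> y /UV2 /hV2; rewrite -tE => /hV1.
apply: contrapT => UT.
have bU : 0 < bary T j (U i).
  have dT : det T != 0 := nT.
  case: (side_eqP nT TE) => -[h3 h4]; have := side_of_bary j (U i) nT;
    have := det_rot T j; rewrite h3 h4 -/p -/q ?(side_ofC p q) => h5 h6.
  - rewrite -(pmulr_rgt0 _ (_ : 0 < det T ^+ 2)); last by rewrite exprn_even_gt0.
    by rewrite expr2 -mulrA -h6 -h5 mulrC.
  - rewrite -(pmulr_rgt0 _ (_ : 0 < det T ^+ 2)); last by rewrite exprn_even_gt0.
    by rewrite expr2 -mulrA -h6 -h5 mulrNN mulrC.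
have [s /andP[s0 s1] hs] := edge_interior nT bU.
apply: (no_overlap hT dV1 TT_T TT_U (nesym UT) TV1 UV1 hs).
have -> : midpoint (T (ordS j)) (T (ord_pred j)) = midpoint p q.
  by case: (side_eqP nT TE) => -[-> ->] //; rewrite midpointC.
apply: hull_conv; first by rewrite (ltW s0).
  by apply: sub_hull; exists i.
by apply: hull_midpoint; [exists (ordS i) | exists (ord_pred i)].
Qed.

End Neighbours.

(** * Angles and sides *)
Section Obtuse.
Context {K : realType}.
Implicit Types (T U : triangle K) (i j : 'I_3) (p q x y z : plane K) (s t : K).

Definition dot_at T i : K := dot (T (ordS i) - T i) (T (ord_pred i) - T i).
Definition sqside T i : K := sqd (T (ordS i)) (T (ord_pred i)).

Lemma dot_atE T i : dot_at T i = power (T (ordS i)) (T (ord_pred i)) (T i).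
Proof. by rewrite /dot_at /power; coords; ring. Qed.

Lemma sqsideE T i :
  sqside T i = sqside T (ordS i) + sqside T (ord_pred i) - 2 * dot_at T i.
Proof.
by rewrite /sqside /dot_at /sqd ordSS ordSK ord_predK ord_predP; coords; ring.
Qed.

Lemma dot_at_sum T i : dot_at T i + dot_at T (ordS i) = sqside T (ord_pred i).
Proof.
by rewrite /sqside /dot_at /sqd ordSS ordSK ord_predK ord_predP; coords; ring.
Qed.

Lemma heron T i :
  16 * area T ^+ 2 = heron16 (sqside T i) (sqside T (ordS i)) (sqside T (ord_pred i)).
Proof.
rewrite areaE exprMn -normrX ger0_norm ?sqr_ge0 // -(det_rot T i).
rewrite /heron16 /sqside /side_of /sqd ordSS ordSK ord_predK ord_predP.
by coords; field.
Qed.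

Lemma obtuseP T : nondegenerate T -> obtuse T <-> exists i, dot_at T i < 0.
Proof.
move=> nT.
suff h i : (pi / 2 < Defs.angle (T i) (T (ordS i)) (T (ord_pred i))) <-> dot_at T i < 0.
  by split=> -[i hi]; exists i; apply/h.
rewrite /Defs.angle -/(dot_at T i).
set a := edist _ _; set b := edist _ _; set d := dot_at T i.
have a0 : 0 < a.
  rewrite sqrtr_gt0 -/(sqd _ _) sqd_gt0 // => /(vertex_inj nT)/eqP.
  by rewrite eq_sym (negbTE (ordS_neq _)).
have b0 : 0 < b.
  rewrite sqrtr_gt0 -/(sqd _ _) sqd_gt0 // => /(vertex_inj nT)/eqP.
  by rewrite eq_sym (negbTE (ord_pred_neq _)).
have ab0 : 0 < a * b by rewrite mulr_gt0.
have hd : d ^+ 2 <= (a * b) ^+ 2.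
  rewrite exprMn !edist_sqr /d /dot_at /sqd.
  have := sqr_ge0 (cross (T (ordS i) - T i) (T (ord_pred i) - T i)).
  coords; nra.
have hd' : -1 <= d / (a * b) <= 1.
  have := le_of_sqr_le (ltW ab0) hd; have := @le_of_sqr_le _ (a * b) (- d) (ltW ab0).
  rewrite sqrrN => /(_ hd) h1 h2.
  by rewrite ler_pdivlMr // ler_pdivrMr // mulN1r mul1r; apply/andP; split; lra.
have pi0 := pi_gt0 K.
set v := d / (a * b) in hd' *.
have -> : (d < 0) = (v < 0) by rewrite /v pmulr_llt0 // invr_gt0.
have [acos_ge acos_le] := andP (acos_def hd').1.
suff -> : (pi / 2 < acos v) = (v < 0) by [].
rewrite -[v in RHS](acos_def hd').2 -[X in _ = (_ < X)](cos_pihalf K).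
rewrite ltr_cos // in_itv /=; apply/andP; split; lra.
Qed.

End Obtuse.

(** * The groups *)
Section Grouping.
Context {K : realType} (r R : K) (P : set (plane K)) (TT : set (triangle K)).
Hypothesis hP : rR_system r R P.
Hypothesis hR : R / r <= 2 * Num.sqrt 2.
Hypothesis hT : delone_triangulation P TT.
Implicit Types (T U : triangle K) (i j k : 'I_3) (p q x y z : plane K) (s t : K).

Let r0 : 0 < r := packing_radius_gt0 hP.
Let ndg := triangle_nondegenerate hT.

Definition rel_side T i : K := sqside T i / r ^+ 2.
Definition rel_area T : K := area T / r ^+ 2.

Lemma covering_radius_le : R ^+ 2 <= 8 * r ^+ 2.
Proof.
have R0 := covering_radius_gt0 hP.
have : R <= 2 * Num.sqrt 2 * r by rewrite -ler_pdivrMr.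
have s2 : Num.sqrt 2 ^+ 2 = 2 :> K by rewrite sqr_sqrtr.
have s0 : 0 <= Num.sqrt 2 :> K := sqrtr_ge0 _.
move=> h; have : R ^+ 2 <= (2 * Num.sqrt 2 * r) ^+ 2.
  by rewrite ler_pXn2r // ?nnegrE ?mulr_ge0 // ltW.
by rewrite !exprMn s2; lra.
Qed.

Lemma rel_side_ge4 T i : TT T -> 4 <= rel_side T i.
Proof.
move=> TT_T; rewrite ler_pdivlMr ?exprn_gt0 //.
apply: (packing_dist hP); try exact: (triangle_vertex hP hT).
exact: (edge_neq (ndg TT_T)).
Qed.

Lemma rel_area_ge0 T : 0 <= rel_area T.
Proof. by rewrite divr_ge0 ?sqr_ge0 // areaE divr_ge0. Qed.

Lemma rel_heron T i : 16 * rel_area T ^+ 2 =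
  heron16 (rel_side T i) (rel_side T (ordS i)) (rel_side T (ord_pred i)).
Proof.
have r2 : r != 0 by rewrite gt_eqF.
rewrite /rel_area /rel_side expr_div_n mulrA (heron T i) /heron16.
by field.
Qed.

Lemma rel_circumradius T i : TT T ->
  rel_side T i * rel_side T (ordS i) * rel_side T (ord_pred i)
    <= 128 * rel_area T ^+ 2.
Proof.
move=> TT_T; have [V [c [Q [dV TV /andP[Q0 QR] _ hV]]]] := triangle_circle hP hT TT_T.
have cT k : sqd c (T k) = Q by have /hV[] : V (T k) by apply: TV; exists k.
have := circumradius_cross (c := c) (p := T (ordS i)) (q := T (ord_pred i)) (x := T i).
rewrite !cT => /(_ erefl erefl) h.
have hprod : sqside T i * sqside T (ordS i) * sqside T (ord_pred i) = 16 * area T ^+ 2 * Q.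
  rewrite areaE exprMn -normrX ger0_norm ?sqr_ge0 // -(det_rot T i).
  have -> : 16 * (side_of (T (ordS i)) (T (ord_pred i)) (T i) ^+ 2 * 2^-1 ^+ 2) * Q =
    4 * cross (T (ord_pred i) - T (ordS i)) (T i - T (ordS i)) ^+ 2 * Q.
    by rewrite /side_of; field.
  rewrite -h /sqside ordSS ordSK ord_predK ord_predP -!mulrA; congr (_ * _).
  by rewrite [sqd (T i) _]sqdC.
have QR' := le_trans QR covering_radius_le.
have r2 : 0 < r ^+ 2 by rewrite exprn_gt0.
rewrite /rel_side /rel_area.
have -> : sqside T i / r ^+ 2 * (sqside T (ordS i) / r ^+ 2) *
    (sqside T (ord_pred i) / r ^+ 2) =
  16 * area T ^+ 2 * Q / (r ^+ 2) ^+ 3.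
  by rewrite -hprod; field; rewrite gt_eqF.
have -> : 128 * (area T / r ^+ 2) ^+ 2 = 16 * area T ^+ 2 * (8 * r ^+ 2) / (r ^+ 2) ^+ 3.
  by field; rewrite gt_eqF.
rewrite ler_pM2r ?invr_gt0 ?exprn_gt0 //; apply: ler_wpM2l => //.
by apply: mulr_ge0 => //; exact: sqr_ge0.
Qed.

Lemma rel_side_obtuse T i : dot_at T i <= 0 ->
  rel_side T (ordS i) + rel_side T (ord_pred i) <= rel_side T i.
Proof.
by move=> h; rewrite /rel_side -mulrDl ler_pM2r ?invr_gt0 ?exprn_gt0 // (sqsideE T i); lra.
Qed.

Lemma rel_side_nonobtuse T i : 0 <= dot_at T i ->
  rel_side T i <= rel_side T (ordS i) + rel_side T (ord_pred i).
Proof.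
by move=> h; rewrite /rel_side -mulrDl ler_pM2r ?invr_gt0 ?exprn_gt0 // (sqsideE T i); lra.
Qed.

Definition small U := obtuse U /\ area U < 2 * r ^+ 2.

(** The angle of [U] at [U i] being obtuse, [side U i] is the longest side of [U]. *)
Definition leans U T j :=
  exists i, [/\ dot_at U i < 0, side T j = side U i & opposite U i T j].

Lemma dot_at_unique T i j : TT T -> dot_at T i < 0 -> j != i -> 0 < dot_at T j.
Proof.
move=> TT_T hi; have pos k : 0 < sqside T k.
  exact/sqd_gt0/(edge_neq (ndg TT_T)).
case: (ord3P i j) => ->; rewrite ?eqxx // => _.
  by have := dot_at_sum T i; have := pos (ord_pred i); lra.
have := dot_at_sum T (ord_pred i); rewrite ord_predK ord_predP.
by have := pos (ordS i); lra.
Qed.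

Lemma leans_side U T j i : TT T -> side T j = side U i -> rel_side T j = rel_side U i.
Proof.
move=> TT_T /(side_eqP (ndg TT_T)); rewrite /rel_side /sqside => -[] [-> ->] //.
by rewrite sqdC.
Qed.

Lemma leans_side_ge8 U T j : TT U -> TT T -> leans U T j -> 8 <= rel_side T j.
Proof.
move=> TT_U TT_T [i [hi sE _]]; rewrite (leans_side TT_T sE).
have := rel_side_obtuse (ltW hi); have := rel_side_ge4 (ordS i) TT_U.
have := rel_side_ge4 (ord_pred i) TT_U; lra.
Qed.

Lemma leans_deficit U T j : TT U -> TT T -> leans U T j ->
  deficit_bound (rel_side T j) (2 - rel_area U).
Proof.
move=> TT_U TT_T [i [hi sE _]]; rewrite (leans_side TT_T sE).
apply: (@obtuse_deficit _ (rel_side U (ordS i)) (rel_side U (ord_pred i)));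
  rewrite ?rel_side_ge4 ?rel_area_ge0 //.
- exact/rel_side_obtuse/ltW.
- by rewrite (rel_heron U (ordS i)) ordSS ordSK.
- by have := rel_circumradius (ordS i) TT_U; rewrite ordSS ordSK.
Qed.

(** The apex of [T] is outside the circumcircle of [U], whose centre lies
    beyond the common side. *)
Lemma leans_acute U T j : TT U -> TT T -> leans U T j -> 0 < dot_at T j.
Proof.
move=> TT_U TT_T [i [hi sE op]].
have pq := edge_neq (ndg TT_U) (i := i).
have Up : vertices U (U (ordS i)) by eexists.
have Uq : vertices U (U (ord_pred i)) by eexists.
have [V [t [dV UV he hV]]] := triangle_pencil hP hT TT_U Up Uq pq.
have /hV[_ pU] : V (U i) by apply: UV; exists i.
have pT := he _ (triangle_vertex hP hT j TT_T).
have -> : dot_at T j = power (U (ordS i)) (U (ord_pred i)) (T j).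
  rewrite dot_atE; case: (side_eqP (ndg TT_T) sE) => -[-> ->] //.
  by rewrite powerC.
move: op hi; rewrite dot_atE pU /opposite => op hi.
apply: lt_le_trans pT; move: op hi.
set a := side_of _ _ _; set b := side_of _ _ _ => ab ta.
have : 0 < (t * a) * (a * b) by rewrite nmulr_rgt0.
have -> : t * a * (a * b) = (t * b) * a ^+ 2 by ring.
have a2 : 0 < a ^+ 2.
  by rewrite exprn_even_gt0 //=; apply: contraTneq ab => ->; rewrite mul0r ltxx.
by rewrite pmulr_lgt0.
Qed.

Lemma leans_unique U U' T j : TT U -> TT U' -> TT T ->
  leans U T j -> leans U' T j -> U = U'.
Proof.
move=> TT_U TT_U' TT_T [i [_ sE op]] [i' [_ sE' op']].
have sUU' : side U' i' = side U i by rewrite -sE' sE.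
apply: (edge_unique hP hT TT_U TT_U' sUU').
move: op op'; rewrite /opposite.
have [[-> ->]|[-> ->]] := side_eqP (ndg TT_U') sUU';
  rewrite ?[side_of (U (ord_pred i)) _ _]side_ofC;
  set a := side_of _ _ (U i); set b := side_of _ _ (U' i'); set c := side_of _ _ (T j).
  move=> ac bc; have : 0 < (a * c) * (b * c) by rewrite nmulr_rgt0.
  have -> : a * c * (b * c) = a * b * c ^+ 2 by ring.
  by rewrite pmulr_lgt0 // exprn_even_gt0 //=; apply: contraTneq ac => ->; rewrite mulr0 ltxx.
rewrite mulrNN; move=> ac bc; have : 0 < (a * c) * (b * c) by rewrite nmulr_rgt0.
have -> : a * c * (b * c) = a * b * c ^+ 2 by ring.
by rewrite pmulr_lgt0 // exprn_even_gt0 //=; apply: contraTneq ac => ->; rewrite mulr0 ltxx.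
Qed.

Lemma leans_index U T j j' : TT U -> TT T -> leans U T j -> leans U T j' -> j = j'.
Proof.
move=> TT_U TT_T [i [hi sE _]] [i' [hi' sE' _]].
apply: (side_inj (ndg TT_T)); rewrite sE sE'; congr side.
by apply/eqP; apply: contraTT hi => /(dot_at_unique TT_U hi') h; rewrite -leNgt ltW.
Qed.

Lemma leans_longest U T j : leans U T j -> TT U -> is_longest_side U (side T j).
Proof.
move=> [i [hi sE _]] TT_U; exists i; split=> // k.
rewrite /side_length edist_le ?edist_ge0 // edist_sqr -!/(sqside _ _).
have h1 := sqsideE U i; have p1 := sqd_ge0 (U (ordS (ordS i))) (U (ord_pred (ordS i))).
have p2 := sqd_ge0 (U (ordS (ord_pred i))) (U (ord_pred (ord_pred i))).
rewrite -!/(sqside _ _) in p1 p2.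
by case: (ord3P i k) => -> //; lra.
Qed.

(** By [leans_acute] the side [j] is not the longest one if [T] is obtuse, so
    that the inequality for one small neighbour applies, with deficit [0]. *)
Lemma leans_not_small U T j : TT U -> TT T -> leans U T j -> ~ small T.
Proof.
move=> TT_U TT_T UT [/(obtuseP (ndg TT_T))[k hk]].
have jk : j != k.
  by apply: contraTneq hk => <-; rewrite -leNgt ltW // (leans_acute TT_U TT_T UT).
have x8 := leans_side_ge8 TT_U TT_T UT.
apply/negP; rewrite -leNgt -ler_pdivlMr ?exprn_gt0 //.
suff : 2 + 0 <= rel_area T by rewrite addr0.
have h0 := rel_side_obtuse (ltW hk).
have db : deficit_bound (rel_side T j) 0 by split; lra.
have hh := rel_heron T k; have hc := rel_circumradius k TT_T.
case: (ord3P k j) jk db x8 => ->; rewrite ?eqxx // => _ db x8.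
  apply: (@obtuse_one_child _ _ (rel_side T (ord_pred k)) (rel_side T k)) x8 _ _ _ _ _ db;
    rewrite ?rel_side_ge4 ?rel_area_ge0 // ?hh /heron16 //; last by lra.
  by ring.
apply: (@obtuse_one_child _ _ (rel_side T (ordS k)) (rel_side T k)) x8 _ _ _ _ _ db;
    rewrite ?rel_side_ge4 ?rel_area_ge0 // ?hh /heron16 //; [lra|ring|lra].
Qed.

Lemma small_leans U : TT U -> small U -> exists T, TT T /\ exists j, leans U T j.
Proof.
move=> TT_U [/(obtuseP (ndg TT_U))[i hi] _].
have [T [j [TT_T sE op]]] := across_edge hP hT i TT_U.
by exists T; split=> //; exists j, i.
Qed.

Definition support U : triangle K := xget U [set T | TT T /\ exists j, leans U T j].

Lemma supportP U : TT U -> small U -> TT (support U) /\ exists j, leans U (support U) j.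
Proof.
move=> TT_U sU; rewrite /support.
exact: (@xgetPex _ U [set T | TT T /\ exists j, leans U T j] (small_leans TT_U sU)).
Qed.

(** Every triangle is sent to the triangle that names its group. *)
Definition carrier U := if `[< small U >] then support U else U.

Lemma carrier_small U : small U -> carrier U = support U.
Proof. by move=> h; rewrite /carrier asboolT. Qed.

Lemma carrier_large U : ~ small U -> carrier U = U.
Proof. by move=> h; rewrite /carrier asboolF. Qed.

Lemma carrier_TT U : TT U -> TT (carrier U) /\ ~ small (carrier U).
Proof.
move=> TT_U; have [sU|sU] := pselect (small U); last by rewrite carrier_large.
rewrite carrier_small //; have [h [j hj]] := supportP TT_U sU; split=> //.
exact: leans_not_small hj.
Qed.

Definition cluster T := [set U | TT U /\ carrier U = T].

Definition leaning T j : option (triangle K) :=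
  if pselect (exists U, [/\ TT U, small U, support U = T & leans U T j]) is left h
  then Some (sval (cid h)) else None.

Lemma leaningP T j U : leaning T j = Some U ->
  [/\ TT U, small U, support U = T & leans U T j].
Proof. by rewrite /leaning; case: pselect => // h [<-]; case: cid. Qed.

Lemma leaningE T j U : TT T -> TT U -> small U -> support U = T -> leans U T j ->
  leaning T j = Some U.
Proof.
move=> TT_T TT_U sU sT UT; rewrite /leaning; case: pselect => [h|]; last by case; exists U.
congr Some; case: cid => U' /= [TT_U' _ _ UT']; exact: leans_unique UT' UT.
Qed.

Definition leaners T i := pmap (leaning T) [:: i; ordS i; ord_pred i].

Lemma mem_leaners T i U : U \in leaners T i <-> exists j, leaning T j = Some U.
Proof.
rewrite /leaners mem_pmap; split=> [/mapP[j _ ->]|[j jU]]; first by exists j.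
apply/mapP; exists j; last by [].
by rewrite !inE; case: (ord3P i j) => ->; rewrite eqxx ?orbT.
Qed.

Lemma clusterE T i : TT T -> ~ small T ->
  cluster T = [set` T :: leaners T i].
Proof.
move=> TT_T sT; apply/seteqP; split=> U /=.
  move=> [TT_U hU]; have [sU|sU] := pselect (small U); last first.
    by rewrite -hU carrier_large // mem_head.
  rewrite carrier_small // in hU; have [_ [j]] := supportP TT_U sU; rewrite hU => UT.
  rewrite in_cons; apply/orP; right; apply/mem_leaners; exists j.
  exact: leaningE.
rewrite in_cons => /predU1P[->|]; first by split=> //; rewrite carrier_large.
move=> /mem_leaners[j /leaningP[TT_U sU sUT _]].
by split=> //; rewrite carrier_small.
Qed.

Lemma leaning_uniq T i : TT T -> ~ small T ->
  uniq (T :: leaners T i).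
Proof.
move=> TT_T sT; rewrite cons_uniq; apply/andP; split.
  by apply/negP => /mem_leaners[j /leaningP[]].
apply: (@pmap_uniq _ _ _ (fun U : triangle K => xget i [set j | leaning T j = Some U])).
  move=> j /=; case E : (leaning T j) => [U|] //=.
  have := @xgetPex _ i [set j | leaning T j = Some U] (ex_intro _ j E).
  move=> /= /leaningP[TT_U _ _ UT]; have [_ _ _ UT'] := leaningP E.
  exact: leans_index UT UT'.
by case: i => [[|[|[|//]]] hi].
Qed.

Lemma mean_area_ge (s : seq (triangle K)) : (0 < size s)%N ->
  2 * (size s)%:R <= \sum_(U <- s) rel_area U -> 2 * r ^+ 2 <= mean_area s.
Proof.
move=> s0; rewrite -mulr_suml /mean_area ler_pdivlMr ?exprn_gt0 // => h.
by rewrite ler_pdivlMr ?ltr0n // mulrAC.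
Qed.

Lemma leaning_bounds T j U : TT T -> leaning T j = Some U ->
  8 <= rel_side T j /\ deficit_bound (rel_side T j) (2 - rel_area U).
Proof.
move=> TT_T /leaningP[TT_U _ _ UT].
by split; [exact: leans_side_ge8 UT | exact: leans_deficit UT].
Qed.

Lemma cluster_nonobtuse T : TT T -> ~ obtuse T -> admissible_group r (cluster T).
Proof.
move=> TT_T oT; have sT : ~ small T by case.
rewrite (clusterE 0 TT_T sT); have us := leaning_uniq 0 TT_T sT.
have child U : U \in leaners T 0 ->
    obtuse U /\ exists S, is_longest_side U S /\ is_side T S.
  move=> /mem_leaners[j /leaningP[TT_U [oU _] _ UT]].
  by split=> //; exists (side T j); split; [exact: leans_longest UT TT_U | exists j].
have ne i : rel_side T i <= rel_side T (ordS i) + rel_side T (ord_pred i).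
  apply: rel_side_nonobtuse; rewrite leNgt; apply/negP => h.
  by apply: oT; apply/(obtuseP (ndg TT_T)); exists i.
have A0 := rel_area_ge0 T; have hh := rel_heron T 0.
have x2 := ne 0; have y2 := ne (ordS 0); have z2 := ne (ord_pred 0).
rewrite ordSS ordSK in y2; rewrite ord_predP ord_predK in z2.
have x4 := rel_side_ge4 0 TT_T; have y4 := rel_side_ge4 (ordS 0) TT_T.
have z4 := rel_side_ge4 (ord_pred 0) TT_T.
have b0 U := @leaning_bounds T 0 U TT_T.
have b1 U := @leaning_bounds T (ordS 0) U TT_T.
have b2 U := @leaning_bounds T (ord_pred 0) U TT_T.
move: b0 b1 b2 child us A0 hh x2 y2 z2 x4 y4 z4; rewrite /leaners /=.
move: (rel_side T 0) (rel_side T (ordS 0)) (rel_side T (ord_pred 0)) => x y z.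
case: (leaning T 0) => [U0|]; case: (leaning T (ordS 0)) => [U1|];
  case: (leaning T (ord_pred 0)) => [U2|] /= b0 b1 b2 child us A0 hh x2 y2 z2 x4 y4 z4;
  try (have [x8 dx] := b0 _ erefl); try (have [y8 dy] := b1 _ erefl);
  try (have [z8 dz] := b2 _ erefl);
  try (apply: GroupAroundNonObtuse => //; apply: mean_area_ge => //;
       rewrite !big_cons big_nil /=).
- have := nonobtuse_three_children x8 y8 z8 x2 _ _ A0 hh dx dy dz; lra.
- have := nonobtuse_two_children x8 y8 z4 x2 _ _ A0 hh dx dy; lra.
- have hxzy : 16 * rel_area T ^+ 2 = heron16 x z y by rewrite hh /heron16; ring.
  have := nonobtuse_two_children x8 z8 y4 _ _ _ A0 hxzy dx dz; lra.
- have := nonobtuse_one_child x8 y4 z4 x2 _ _ A0 hh dx; lra.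
- have hyzx : 16 * rel_area T ^+ 2 = heron16 y z x by rewrite hh /heron16; ring.
  have := nonobtuse_two_children y8 z8 x4 _ _ _ A0 hyzx dy dz; lra.
- have hyxz : 16 * rel_area T ^+ 2 = heron16 y x z by rewrite hh /heron16; ring.
  have := nonobtuse_one_child y8 x4 z4 _ _ _ A0 hyxz dy; lra.
- have hzxy : 16 * rel_area T ^+ 2 = heron16 z x y by rewrite hh /heron16; ring.
  have := nonobtuse_one_child z8 x4 y4 _ _ _ A0 hzxy dz; lra.
- by rewrite set_cons1; exact: GroupNonObtuse.
Qed.

Lemma cluster_obtuse T : TT T -> obtuse T -> ~ small T -> admissible_group r (cluster T).
Proof.
move=> TT_T oT sT; have [i hi] := (obtuseP (ndg TT_T)).1 oT.
have aT : 2 * r ^+ 2 <= area T by rewrite leNgt; apply/negP => h; apply: sT.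
rewrite (clusterE i TT_T sT); have us := leaning_uniq i TT_T sT.
have iN : leaning T i = None.
  case E : (leaning T i) => [U|] //; have [TT_U _ _ UT] := leaningP E.
  by have := leans_acute TT_U TT_T UT; rewrite ltNge ltW.
have child U : U \in leaners T i -> obtuse U /\ exists S,
    [/\ is_longest_side U S, is_side T S & ~ is_longest_side T S].
  move=> /mem_leaners[j jU]; have [TT_U [oU _] _ UT] := leaningP jU.
  split=> //; exists (side T j); split; [exact: leans_longest UT TT_U | by exists j |].
  move=> [k [/(side_inj (ndg TT_T)) <- /(_ i)]].
  rewrite /side_length edist_le ?edist_ge0 // edist_sqr -!/(sqside _ _) leNgt => /negP; apply.
  have := leans_acute TT_U TT_T UT; have := sqsideE T i.
  have pS : 0 < sqside T (ordS i) by exact/sqd_gt0/(edge_neq (ndg TT_T)).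
  have pP : 0 < sqside T (ord_pred i) by exact/sqd_gt0/(edge_neq (ndg TT_T)).
  by case: (ord3P i j) jU => -> jU; rewrite ?jU // in iN *; lra.
have A0 := rel_area_ge0 T; have hh := rel_heron T (ordS i).
have hc := rel_circumradius (ordS i) TT_T.
rewrite ordSS ordSK in hh hc.
have z2 := rel_side_obtuse (ltW hi).
have x4 := rel_side_ge4 (ordS i) TT_T; have y4 := rel_side_ge4 (ord_pred i) TT_T.
have b1 U := @leaning_bounds T (ordS i) U TT_T.
have b2 U := @leaning_bounds T (ord_pred i) U TT_T.
move: b1 b2 child us A0 hh hc z2 x4 y4; rewrite /leaners /= iN /=.
move: (rel_side T i) (rel_side T (ordS i)) (rel_side T (ord_pred i)) => z x y.
case: (leaning T (ordS i)) => [U1|]; case: (leaning T (ord_pred i)) => [U2|] /=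
    b1 b2 child us A0 hh hc z2 x4 y4;
  try (have [x8 dx] := b1 _ erefl); try (have [y8 dy] := b2 _ erefl);
  try (apply: GroupAroundObtuse => //; apply: mean_area_ge => //;
       rewrite !big_cons big_nil /=).
- have := obtuse_two_children x8 y8 z2 A0 hh hc dx dy; lra.
- have := obtuse_one_child x8 y4 z2 A0 hh hc dx; lra.
- have hyx : 16 * rel_area T ^+ 2 = heron16 y x z by rewrite hh /heron16; ring.
  rewrite [x * y]mulrC in hc; have := obtuse_one_child y8 x4 _ A0 hyx hc dy; lra.
- by rewrite set_cons1; exact: GroupObtuse.
Qed.

Theorem admissible_partition : exists G : set (set (triangle K)),
  partition G id TT /\ forall g, G g -> admissible_group r g.
Proof.
exists [set cluster T | T in [set T | TT T /\ ~ small T]]; split; last first.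
  move=> _ [T [TT_T sT] <-]; have [oT|oT] := pselect (obtuse T).
    exact: cluster_obtuse.
  exact: cluster_nonobtuse.
split.
- apply/seteqP; split=> U; first by move=> [_ [T _ <-] []].
  by move=> TT_U; exists (cluster (carrier U)) => //; exists (carrier U) => //; exact: carrier_TT.
- move=> _ _ [T _ <-] [T' _ <-] [U [[_ /= hT'] [_ hT'']]].
  by rewrite -hT' -hT''.
- by move=> _ [T [TT_T sT] <-]; exists T; split=> //; rewrite carrier_large.
Qed.

End Grouping.

(** * Counting triangles in large discs *)
Section Average.
Context {K : realType} (r R : K) (P : set (plane K)) (TT : set (triangle K)).
Hypothesis hP : rR_system r R P.
Hypothesis hT : delone_triangulation P TT.
Implicit Types (T U : triangle K) (i j k : 'I_3) (p q x y z c : plane K).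

Let r0 : 0 < r := packing_radius_gt0 hP.
Let R0 : 0 < R := covering_radius_gt0 hP.

Lemma hull_disc (A : set (plane K)) s : 0 <= s -> A `<=` disc 0 s -> hull A `<=` disc 0 s.
Proof.
move=> s0; apply: hull_sub => x y t /andP[t0 t1].
rewrite /disc /= !edist_le // => hx hy.
have : 0 <= t * (1 - t) * sqd x y by rewrite !mulr_ge0 ?sqd_ge0 // subr_ge0.
have : 0 <= t * (s ^+ 2 - sqd 0 x) by rewrite mulr_ge0 // subr_ge0.
have : 0 <= (1 - t) * (s ^+ 2 - sqd 0 y) by rewrite mulr_ge0 // subr_ge0.
have -> : sqd 0 (t *: x + (1 - t) *: y) =
    t * sqd 0 x + (1 - t) * sqd 0 y - t * (1 - t) * sqd x y.
  by rewrite /sqd; coords; ring.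
lra.
Qed.

Lemma triangle_in_disc T s : 0 <= s ->
  (hull (vertices T) `<=` disc 0 s) <-> forall i, edist 0 (T i) <= s.
Proof.
move=> s0; split=> [h i|h]; first by apply: h; apply: sub_hull; exists i.
by apply: hull_disc => // _ [i _ <-]; exact: h.
Qed.

Lemma triangle_diameter T i j : TT T -> edist (T i) (T j) <= 2 * R.
Proof.
move=> TT_T; have [V [c [Q [dV TV /andP[Q0 QR] _ hV]]]] := triangle_circle hP hT TT_T.
have cT k : edist c (T k) <= R.
  rewrite edist_le ?(ltW R0) //.
  by have /hV[_ ->] : V (T k) by apply: TV; exists k.
apply: le_trans (edist_triangle c _ _) _; rewrite edistC.
by have := cT i; have := cT j; lra.
Qed.

Lemma coord_le_edist x y : `|x 0 0 - y 0 0| <= edist x y /\ `|x 0 1 - y 0 1| <= edist x y.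
Proof. by apply: coord_le_sqd; rewrite ?edist_ge0 // edist_sqr. Qed.

(** A point of the system and its nearest neighbour span the diameter of an
    empty circle, from which the pencil reaches a Delone polygon. *)
Lemma triangle_near c : exists2 T, TT T & forall i, edist c (T i) <= 3 * R.
Proof.
have [p Pp cp] := covering_point hP c.
have [x0 Px0 hx0] := covering_point hP (p + (\row_j (3 * R))).
pose A := P `&` [set x | x <> p /\ sqd p x <= sqd p x0].
have fA : finite_set A.
  by apply: sub_finite_set (finite_disc hP p (sqd p x0)) => x [Px [_ hx]].
have A0 : A !=set0.
  exists x0; split=> //; split=> // xp; move: hx0; rewrite xp /sqd; coords.
  have R2 : 0 < R ^+ 2 by rewrite exprn_gt0.
  by lra.
have [q [Pq [qp hq]] qmin] := finite_argmin (sqd p) fA A0.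
have pq : p <> q by exact: nesym.
have he : empty_pencil P p q 0.
  move=> x Px; rewrite mul0r.
  have [->|xp] := pselect (x = p); first by rewrite /power; coords; rewrite !subrr !mul0r addr0.
  have h : sqd p q <= sqd p x.
    have [hx|hx] := leP (sqd p x) (sqd p x0); first by apply: qmin.
    by apply: le_trans (ltW hx).
  have -> : power p q x = (sqd p x + sqd q x - sqd p q) / 2.
    by rewrite /power /sqd; coords; field.
  by have := sqd_ge0 q x; lra.
have [x [t [Px sx _ xE et]]] := pencil_grow hP Pp Pq pq he.
have dV : delone_vertices P [set y | P y /\ power p q y = t * side_of p q y].
  by apply: (delone_of_pencil Pp Pq Px) => //; apply/eqP; rewrite gt_eqF.
set V := [set y | _] in dV.
have Vp : V p by split=> //; rewrite /power /side_of; coords; ring.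
have [_ _ hcov] := hT.2 V dV.
have : hull V p by exact: sub_hull.
rewrite -hcov => -[T [TT_T TV] _]; exists T => // i.
have [c' [Q [/andP[Q0 QR] _ hV]]] := delone_circle hP dV.
have h1 : edist c' p <= R by rewrite edist_le ?(ltW R0) //; have /hV[_ ->] := Vp.
have h2 : edist c' (T i) <= R.
  rewrite edist_le ?(ltW R0) //.
  by have /hV[_ ->] : V (T i) by apply: TV; exists i.
have h3 : edist c p <= R by rewrite edist_le ?(ltW R0).
have := edist_triangle p c (T i); have := edist_triangle c' p (T i).
by rewrite (edistC p c'); lra.
Qed.

Definition in_disc s := TT `&` [set T | hull (vertices T) `<=` disc 0 s].

Lemma residue_vertex d x y : P x -> P y -> edist x y <= d ->
  residue r d (x 0 0) = residue r d (y 0 0) ->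
  residue r d (x 0 1) = residue r d (y 0 1) -> x = y.
Proof.
move=> Px Py xyd /(residue_inj r0) h0 /(residue_inj r0) h1.
have [hx hy] := coord_le_edist x y.
by apply: (cell_inj hP) => //; [apply: h0 | apply: h1]; exact: le_trans xyd.
Qed.

Lemma finite_in_disc s : finite_set (in_disc s).
Proof.
have [s0|s0] := leP 0 s; last first.
  rewrite (_ : in_disc s = set0); first exact: finite_set0.
  rewrite -subset0 => T [_ /(_ (T 0))] /=.
  have : hull (vertices T) (T 0) by apply: sub_hull; exists 0.
  by move=> h /(_ h); rewrite /disc /= leNgt (lt_le_trans s0) // edist_ge0.
pose key T := [ffun i : 'I_3 => (residue r (2 * s) (T i 0 0), residue r (2 * s) (T i 0 1))].
apply: (finite_injective (f := key)).
move=> T U [TT_T /triangle_in_disc hT'] [TT_U /triangle_in_disc hU] h.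
apply/ffunP => i; move/ffunP/(_ i) : h; rewrite !ffunE => -[].
apply: (residue_vertex (triangle_vertex hP hT i TT_T) (triangle_vertex hP hT i TT_U)).
apply: le_trans (edist_triangle 0 _ _) _; rewrite edistC.
by have := hT' s0 i; have := hU s0 i; lra.
Qed.

(** The squared radii differ by at most [2 * w * s] and the squared abscissas by at
    most [2 * r * s]; and the square of the difference of two nonnegative heights
    is at most the difference of their squares. *)
Lemma annulus_column s w p q : 0 <= s -> 0 <= w ->
  s - w <= edist 0 p <= s -> s - w <= edist 0 q <= s ->
  `|p 0 0 - q 0 0| <= r -> (0 <= p 0 1) = (0 <= q 0 1) ->
  `|p 0 1 - q 0 1| <= Num.sqrt (2 * (w + r) * s).
Proof.
move=> s0 w0; wlog qp : p q / `|q 0 1| <= `|p 0 1| => [hw hp hq hpq hs|].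
  have [qp|/ltW qp] := leP `|q 0 1| `|p 0 1|; first exact: hw.
  by rewrite distrC; apply: hw; rewrite // distrC.
move=> /andP[_ ps] /andP[qs qs'] xpq hs.
have [xp _] := coord_le_edist 0 p; have [xq _] := coord_le_edist 0 q.
have ps2 : p 0 0 ^+ 2 + p 0 1 ^+ 2 <= s ^+ 2.
  by move: ps; rewrite edist_le // /sqd; coords; lra.
have qs2 : s ^+ 2 - 2 * w * s <= q 0 0 ^+ 2 + q 0 1 ^+ 2.
  have -> : q 0 0 ^+ 2 + q 0 1 ^+ 2 = edist 0 q ^+ 2 by rewrite edist_sqr /sqd; coords; ring.
  have := edist_ge0 0 q; set d := edist 0 q in qs qs' *; move=> d0.
  have [sw|sw] := leP s w; nra.
have hx : q 0 0 ^+ 2 - p 0 0 ^+ 2 <= 2 * r * s.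
  move: xp xq xpq; rewrite !mxE !sub0r !normrN !ler_norml.
  move=> /andP[a1 a2] /andP[b1 b2] /andP[c1 c2].
  have : 0 <= (q 0 0 - p 0 0 + r) * (r + p 0 0 - q 0 0) by apply: mulr_ge0; lra.
  have [h|h] := leP 0 (q 0 0 + p 0 0).
    have : 0 <= (r + p 0 0 - q 0 0) * (q 0 0 + p 0 0) by apply: mulr_ge0; lra.
    have : r * (q 0 0 + p 0 0) <= r * (2 * s) by rewrite ler_pM2l //; lra.
    lra.
  have : 0 <= (q 0 0 - p 0 0 + r) * (- (q 0 0 + p 0 0)) by apply: mulr_ge0; lra.
  have : r * (- (q 0 0 + p 0 0)) <= r * (2 * s) by rewrite ler_pM2l //; lra.
  lra.
have hy : (p 0 1 - q 0 1) ^+ 2 <= p 0 1 ^+ 2 - q 0 1 ^+ 2.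
  suff : 0 <= q 0 1 * (p 0 1 - q 0 1) by lra.
  move: hs qp; have [h1|h1] := leP 0 (q 0 1); have [h2|h2] := leP 0 (p 0 1) => // _.
    by rewrite !ger0_norm // => h; apply: mulr_ge0; lra.
  by rewrite !ltr0_norm // => h; rewrite mulr_le0 //; lra.
have c0 : 0 <= 2 * (w + r) * s by rewrite !mulr_ge0 // addr_ge0 // ltW.
apply: le_of_sqr_le; first exact: sqrtr_ge0.
rewrite sqr_sqrtr // real_normK ?num_real //; lra.
Qed.

Lemma modulus_le d : 0 <= d -> ((modulus r d).+1)%:R <= d / r + 2.
Proof.
move=> d0; rewrite /modulus -[_.+2]addn2 natrD lerD2r.
by rewrite truncn_le divr_ge0 // ltW.
Qed.

(** The first vertex of a triangle is determined by the side of the horizontal axis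
    that it is on, by its column, and by its row modulo the height of the annulus
    in one column; the other two vertices are determined by their positions
    relative to the first one. *)
Lemma boundary_count w s (l : seq (triangle K)) : 0 <= s -> 0 <= w -> uniq l ->
  (forall T, T \in l -> [/\ TT T, edist 0 (T 0) <= s & s - w <= edist 0 (T 0)]) ->
  (size l)%:R <= 2 * (2 * s / r + 2) * (Num.sqrt (2 * (w + r) * s) / r + 2)
    * (4 * R / r + 2) ^+ 4.
Proof.
move=> s0 w0 ul hl; set d := Num.sqrt _.
have d0 : 0 <= d := sqrtr_ge0 _.
pose key T := ((0 <= T 0 0 1, (residue r (2 * s) (T 0 0 0), residue r d (T 0 0 1))),
  ((residue r (4 * R) (T 1 0 0), residue r (4 * R) (T 1 0 1)),
   (residue r (4 * R) (T 2 0 0), residue r (4 * R) (T 2 0 1)))).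
have keyinj : {in l &, injective key}.
  move=> T U /hl[TT_T Ts Tw] /hl[TT_U Us Uw] [] hsgn hx hy h10 h11 h20 h21.
  have TP i := triangle_vertex hP hT i TT_T; have UP i := triangle_vertex hP hT i TT_U.
  have [xT _] := coord_le_edist 0 (T 0); have [xU _] := coord_le_edist 0 (U 0).
  have hx0 : cell r (T 0 0 0) = cell r (U 0 0 0).
    apply: (residue_inj r0) hx; move: xT xU; rewrite !mxE !sub0r !normrN !ler_norml.
    by move=> /andP[? ?] /andP[? ?]; apply/andP; split; lra.
  have hy0 : cell r (T 0 0 1) = cell r (U 0 0 1).
    apply: (residue_inj r0) hy; apply: annulus_column => //; try by apply/andP.
    exact/ltW/(cell_close r0).
  have E0 := cell_inj hP (TP 0) (UP 0) hx0 hy0.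
  have hd i : edist (T i) (U i) <= 4 * R.
    apply: le_trans (edist_triangle (T 0) _ _) _; rewrite {2}E0.
    by have := triangle_diameter i 0 TT_T; have := triangle_diameter 0 i TT_U; lra.
  have E1 := residue_vertex (TP 1) (UP 1) (hd 1) h10 h11.
  have E2 := residue_vertex (TP 2) (UP 2) (hd 2) h20 h21.
  apply/ffunP => k; case: (ord3P 0 k) => -> //.
    by rewrite (_ : ordS 0 = 1) //; apply: val_inj.
  by rewrite (_ : ord_pred 0 = 2) //; apply: val_inj.
have := size_injective ul keyinj.
rewrite !card_prod card_bool !card_ord -(ler_nat K) !natrM => /le_trans; apply.
have m1 := modulus_le (mulr_ge0 (ler0n _ 2) s0); have m2 := modulus_le d0.
have m3 := modulus_le (mulr_ge0 (ler0n _ 4) (ltW R0)).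
move: m1 m2 m3; set a := (modulus r (2 * s)).+1%:R; set b := (modulus r d).+1%:R.
set c := (modulus r (4 * R)).+1%:R => m1 m2 m3.
have -> : 2 * (a * b) * (c * c * (c * c)) = 2 * (a * b) * c ^+ 4 by ring.
have a0 : 0 <= a := ler0n _ _; have b0 : 0 <= b := ler0n _ _.
have c0 : 0 <= c := ler0n _ _.
apply: ler_pM; rewrite ?exprn_ge0 ?mulr_ge0 //; last first.
  by apply: lerXn2r; rewrite ?nnegrE // (le_trans c0).
by rewrite -mulrA ler_pM2l //; exact: ler_pM.
Qed.

(** Triangles near distinct points of a square grid of step [8 R] are distinct. *)
Lemma in_disc_count N s (l : seq (triangle K)) :
  (forall T, in_disc s T -> T \in l) -> 16 * R * N%:R + 6 * R <= s -> (N ^ 2 <= size l)%N.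
Proof.
move=> hl hs; have s0 : 0 <= s.
  by apply: le_trans hs; rewrite addr_ge0 // ?mulr_ge0 // ltW.
pose c (ij : 'I_N * 'I_N) : plane K :=
  \row_k (if k == 0 then 8 * R * (ij.1 : nat)%:R else 8 * R * (ij.2 : nat)%:R).
have /choice[f hf] ij : exists T, TT T /\ forall i, edist (c ij) (T i) <= 3 * R.
  by have [T] := triangle_near (c ij); exists T.
have finj : injective f.
  move=> [i j] [i' j'] E.
  have [_ h1] := hf (i, j); have [_ h2] := hf (i', j'); rewrite -E in h2.
  have : edist (c (i, j)) (c (i', j')) <= 6 * R.
    apply: le_trans (edist_triangle (f (i, j) 0) _ _) _.
    by have := h1 0; have := h2 0; rewrite [edist (f _ _) _]edistC; lra.
  have [hx hy] := coord_le_edist (c (i, j)) (c (i', j')).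
  have eqn (a b : 'I_N) : `|8 * R * (a : nat)%:R - 8 * R * (b : nat)%:R| <= 6 * R -> a = b.
    wlog ab : a b / (a <= b)%N => [hw h|].
      have [ab|/ltnW ab] := leqP a b; first exact: hw.
      by apply/esym/hw => //; rewrite distrC.
    rewrite ler_norml => /andP[h _]; apply/eqP; rewrite -val_eqE eqn_leq ab /=.
    rewrite leqNgt; apply/negP => ba; move: h.
    have : (a : nat)%:R + 1 <= (b : nat)%:R :> K by rewrite natr1 ler_nat.
    have := R0; nra.
  move=> h; have := le_trans hx h; have := le_trans hy h; rewrite !mxE /= => /eqn -> /eqn -> //.
have : (size (map f (enum {: 'I_N * 'I_N})) <= size l)%N.
  apply: uniq_leq_size; first by rewrite map_inj_uniq // enum_uniq.
  move=> _ /mapP[ij _ ->]; have [TTf h] := hf ij; apply: hl; split=> //=.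
  apply/triangle_in_disc => // i.
  apply: le_trans (edist_triangle (c ij) _ _) _.
  suff : edist 0 (c ij) <= 16 * R * N%:R by have := h i; have := R0; lra.
  have n0 : 0 <= N%:R :> K by [].
  have i1 : (ij.1 : nat)%:R <= N%:R :> K by rewrite ler_nat ltnW.
  have i2 : (ij.2 : nat)%:R <= N%:R :> K by rewrite ler_nat ltnW.
  have i10 : 0 <= (ij.1 : nat)%:R :> K by [].
  have i20 : 0 <= (ij.2 : nat)%:R :> K by [].
  rewrite edist_le; last by rewrite !mulr_ge0 // ltW.
  rewrite /sqd; coords => /=; move: i1 i2 i10 i20.
  move: ((ij.1 : nat)%:R : K) ((ij.2 : nat)%:R : K) => a b a1 b1 a0 b0.
  have : 0 <= R ^+ 2 * (N%:R ^+ 2 - a ^+ 2) by rewrite mulr_ge0 ?sqr_ge0 // subr_ge0 lerXn2r.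
  have : 0 <= R ^+ 2 * (N%:R ^+ 2 - b ^+ 2) by rewrite mulr_ge0 ?sqr_ge0 // subr_ge0 lerXn2r.
  have : 0 <= R ^+ 2 * N%:R ^+ 2 by rewrite mulr_ge0 ?sqr_ge0.
  nra.
by rewrite size_map -cardE card_prod card_ord mulnn.
Qed.

End Average.

(** * The lower bound on the average area *)
Section AverageBound.
Context {K : realType} (r R : K) (P : set (plane K)) (TT : set (triangle K)).
Context (G : set (set (triangle K))) (m : K).
Hypothesis hP : rR_system r R P.
Hypothesis hT : delone_triangulation P TT.
Hypothesis hG : partition G id TT.
Hypothesis hadm : forall g, G g -> admissible_group r g.
Hypothesis m0 : 0 <= m.
Hypothesis mr : m <= 2 * r ^+ 2.
Hypothesis marea : forall T, TT T -> ~ obtuse T -> m <= area T.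
Implicit Types (T U : triangle K) (g : set (triangle K)) (l s : seq (triangle K)).

Let R0 : 0 < R := covering_radius_gt0 hP.

Lemma area_ge0 T : 0 <= area T.
Proof. by rewrite areaE divr_ge0. Qed.

Lemma mean_area_sum s : 2 * r ^+ 2 <= mean_area s ->
  m * (size s)%:R <= \sum_(T <- s) area T.
Proof.
case: s => [|T s] h; first by rewrite big_nil mulr0.
rewrite -ler_pdivlMr ?ltr0n //; exact: le_trans mr h.
Qed.

Lemma longest_side_shared U T (S : set (plane K)) : is_longest_side U S -> is_side T S ->
  exists i j, U i = T j.
Proof.
move=> [i [-> _]] [j h]; exists (ordS i).
have [->|->] : side T j (U (ordS i)) by rewrite -h; left.
  by exists (ordS j).
by exists (ord_pred j).
Qed.

(** The triangle [T] meets all the triangles of its group, which are therefore near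
    to each other. *)
Lemma admissible_group_sum g : admissible_group r g -> g `<=` TT ->
  exists l T, [/\ uniq l, g = [set` l], m * (size l)%:R <= \sum_(U <- l) area U
    & TT T /\ forall U, U \in l -> exists i j, U i = T j].
Proof.
case=> [T oT|T oT aT|T s oT _ us hs ms|T s oT _ us hs ms] gTT.
- exists [:: T], T; split=> //; first by rewrite set_cons1.
    by rewrite big_seq1 mulr1; apply: marea => //; exact: gTT.
  split; first exact: gTT.
  by move=> U; rewrite inE => /eqP ->; exists 0, 0.
- exists [:: T], T; split=> //; first by rewrite set_cons1.
    by rewrite big_seq1 mulr1; exact: le_trans aT.
  split; first exact: gTT.
  by move=> U; rewrite inE => /eqP ->; exists 0, 0.
- exists (T :: s), T; split=> //; first exact: mean_area_sum.
  split; first by apply: gTT; rewrite /= mem_head.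
  move=> U; rewrite inE => /predU1P[->|/hs[_ [S [h1 h2]]]]; first by exists 0, 0.
  exact: longest_side_shared h1 h2.
- exists (T :: s), T; split=> //; first exact: mean_area_sum.
  split; first by apply: gTT; rewrite /= mem_head.
  move=> U; rewrite inE => /predU1P[->|/hs[_ [S [h1 h2 _]]]]; first by exists 0, 0.
  exact: longest_side_shared h1 h2.
Qed.

Lemma group_of T : TT T -> exists2 g, G g & g T.
Proof. by case: hG => <- _ _ [g Gg gT]; exists g. Qed.

Lemma group_sub g : G g -> g `<=` TT.
Proof. by case: hG => <- _ _ Gg T gT; exists g. Qed.

Lemma group_eq g g' T : G g -> G g' -> g T -> g' T -> g = g'.
Proof. by case: hG => _ tG _ Gg Gg' gT g'T; apply: tG => //; exists T. Qed.

(** A finite set of triangles that is a union of groups is exhausted by removing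
    one group at a time. *)
Lemma closed_sum s : uniq s -> (forall T, T \in s -> TT T) ->
  (forall T U g, T \in s -> G g -> g T -> g U -> U \in s) ->
  m * (size s)%:R <= \sum_(T <- s) area T.
Proof.
have [n] := ubnP (size s); elim: n s => // n IH [|T s'] hn us sTT cl.
  by rewrite big_nil mulr0.
set s := T :: s' in hn us sTT cl *.
have Ts : T \in s by exact: mem_head.
have [g Gg gT] := group_of (sTT _ Ts).
have [l [_ [ul gE hl _]]] := admissible_group_sum (hadm Gg) (group_sub Gg).
have ls : {subset l <= s}.
  by move=> U Ul; apply: (cl T U g) => //; rewrite gE.
have lE : perm_eq l ([seq U <- s | U \in l]).
  apply: uniq_perm => //; first exact: filter_uniq.
  move=> U; rewrite mem_filter /=; have [Ul|//] := boolP (U \in l).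
  by rewrite (ls _ Ul).
have sE : size s = (size l + size [seq U <- s | U \notin l])%N.
  by rewrite -(count_predC (mem l) s) (perm_size lE) !size_filter.
rewrite {1}sE natrD mulrDr (bigID (mem l)); apply: lerD.
  by rewrite -big_filter -(perm_big _ lE).
rewrite -[X in _ <= X]big_filter.
apply: IH; rewrite ?filter_uniq //.
- have l0 : (0 < size l)%N by move: gT; rewrite gE /=; case: (l).
  by move: hn; rewrite sE ltnS; apply: leq_trans; rewrite -[X in (X < _)%N]add0n ltn_add2r.
- by move=> U; rewrite mem_filter => /andP[_ /sTT].
- move=> U V g' ; rewrite !mem_filter /= => /andP[Ul Us] Gg' g'U g'V.
  rewrite (cl U V g') // andbT; apply: contra Ul => Vl.
  have gV : g V by rewrite gE.
  have : g U by rewrite (group_eq Gg Gg' gV g'V).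
  by rewrite gE.
Qed.

Definition complete (rho : K) T :=
  `[< forall g U, G g -> g T -> g U -> hull (vertices U) `<=` disc 0 rho >].

Lemma complete_sum rho s : uniq s -> (forall T, T \in s <-> in_disc TT rho T) ->
  m * (count (complete rho) s)%:R <= \sum_(T <- s) area T.
Proof.
move=> us hs; rewrite (bigID (complete rho)) /= -big_filter -size_filter.
apply: ler_wpDr; first by apply: sumr_ge0 => T _; exact: area_ge0.
apply: closed_sum; rewrite ?filter_uniq //.
  by move=> T; rewrite mem_filter => /andP[_ /hs[]].
move=> T U g; rewrite !mem_filter => /andP[/asboolP cT Ts] Gg gT gU.
apply/andP; split.
  apply/asboolP => g' W Gg' g'U g'W; apply: (cT _ _ Gg gT).
  by rewrite (group_eq Gg Gg' gU g'U).
apply/hs; split; first exact: (group_sub Gg gU).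
exact: (cT _ _ Gg gT gU).
Qed.

Lemma incomplete_far rho T : 0 <= rho -> in_disc TT rho T -> ~~ complete rho T ->
  rho - 6 * R <= edist 0 (T 0).
Proof.
move=> rho0 [TT_T _] /asboolPn.
move=> /existsNP[g /existsNP[U /not_implyP[Gg /not_implyP[gT /not_implyP[gU]]]]].
move=> hU; rewrite leNgt; apply/negP => hT0; apply: hU.
apply/triangle_in_disc => // i.
have [l [V [_ gE _ [TT_V hl]]]] := admissible_group_sum (hadm Gg) (group_sub Gg).
have [j [k hj]] : exists i j, T i = V j by apply: hl; move: gT; rewrite gE.
have [j' [k' hj']] : exists i j, U i = V j by apply: hl; move: gU; rewrite gE.
have dT := triangle_diameter hP hT 0 j TT_T.
have dV := triangle_diameter hP hT k k' TT_V; rewrite -hj -hj' in dV.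
have dU := triangle_diameter hP hT j' i (group_sub Gg gU).
have t1 := edist_triangle (T 0) 0 (U i); have t2 := edist_triangle (T j) (T 0) (U i).
have t3 := edist_triangle (U j') (T j) (U i).
lra.
Qed.

(** The incomplete triangles contribute a nonnegative area, so that they lower the
    mean by at most [m] times their proportion, of the order of [rho ^ (-1/2)]. *)
Lemma average_lower_bound : (m%:E <= average_area TT)%E.
Proof.
have r0 := packing_radius_gt0 hP.
rewrite /average_area limf_einfE; apply/lee_subgt0Pr => e e0.
(* With [sg = sqrt rho], there are at most [C * sg ^ 3] incomplete triangles and at
   least [(sg ^ 2 / (32 * R)) ^ 2] triangles in all; [B] is the bound that
   [sg] has to exceed. *)
pose a := Num.sqrt (2 * (6 * R + r)).
pose C := 2 * (2 / r + 2) * (a / r + 2) * (4 * R / r + 2) ^+ 4.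
pose B := m * C * (32 * R) ^+ 2 / e.
have a0 : 0 <= a := sqrtr_ge0 _.
have rV : 0 < r^-1 by rewrite invr_gt0.
have C1 : 0 <= 2 / r + 2 by rewrite addr_ge0 // divr_ge0 // ltW.
have C2 : 0 <= a / r + 2 by rewrite addr_ge0 // divr_ge0 // ltW.
have C3 : 0 <= 4 * R / r + 2 by rewrite addr_ge0 // divr_ge0 ?mulr_ge0 // ltW.
have C0 : 0 <= C by rewrite /C !mulr_ge0 // exprn_ge0.
have B0 : 0 <= B by rewrite divr_ge0 ?mulr_ge0 ?sqr_ge0 // ltW.
pose rho0 := 1 + 44 * R + B ^+ 2.
have hV : pinfty_nbhs K [set rho | rho0 < rho].
  by exists rho0; split => //; exact: num_real.
apply: le_trans (ereal_sup_ubound (ex_intro2 _ _ _ hV erefl)).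
apply/ereal_infP => _ [rho /= hrho <-].
rewrite -EFinB lee_fin.
have B2 : 0 <= B ^+ 2 := sqr_ge0 B.
have hR0 : 0 < R := R0.
have rho1 : 1 <= rho by move: hrho; rewrite /rho0; lra.
have rhoR : 44 * R <= rho by move: hrho; rewrite /rho0; lra.
have rho_pos : 0 <= rho by lra.
have fin := finite_in_disc hP hT rho.
set s := finmap.enum_fset _.
have us : uniq s := finmap.fset_uniq _.
have hs T : T \in s <-> in_disc TT rho T.
  have -> : (T \in s) = (T \in in_disc TT rho) := in_fset_set fin T.
  by rewrite inE.
have hcomp := complete_sum us hs.
have hcount := count_predC (complete rho) s.
set nb := count (predC _) _ in hcount.
have hnb : nb%:R <= 2 * (2 * rho / r + 2) * (Num.sqrt (2 * (6 * R + r) * rho) / r + 2)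
    * (4 * R / r + 2) ^+ 4.
  rewrite /nb -size_filter; apply: (boundary_count hP hT) => //; first by lra.
    exact: filter_uniq.
  move=> T; rewrite mem_filter => /andP[/= cT /hs Ts]; split; first by case: Ts.
    by have [_ h] := Ts; exact: ((triangle_in_disc T rho_pos).1 h 0).
  exact: incomplete_far.
pose sg := Num.sqrt rho.
have sg2 : sg ^+ 2 = rho by rewrite sqr_sqrtr.
have sg1 : 1 <= sg by rewrite -(ler_pXn2r (n := 2)) ?nnegrE ?sqrtr_ge0 // sg2 expr1n.
have hnb' : nb%:R <= C * sg ^+ 3.
  apply: le_trans hnb _; rewrite sqrtrM -/a -/sg; last by lra.
  have h1 : 2 * rho / r + 2 <= (2 / r + 2) * sg ^+ 2.
    have -> : 2 * rho / r = 2 / r * rho by ring.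
    rewrite sg2; have -> : (2 / r + 2) * rho = 2 / r * rho + 2 * rho by ring.
    by apply: lerD => //; lra.
  have h2 : a * sg / r + 2 <= (a / r + 2) * sg.
    have -> : (a / r + 2) * sg = a * sg / r + 2 * sg by ring.
    by apply: lerD => //; lra.
  have -> : C * sg ^+ 3 =
      2 * ((2 / r + 2) * sg ^+ 2) * ((a / r + 2) * sg) * (4 * R / r + 2) ^+ 4.
    by rewrite /C; ring.
  apply: ler_wpM2r; first by rewrite exprn_ge0.
  have h3 : 0 <= 2 * rho / r + 2 by rewrite addr_ge0 // divr_ge0 ?mulr_ge0 // ltW.
  have h4 : 0 <= a * sg / r + 2 by rewrite addr_ge0 // divr_ge0 ?mulr_ge0 ?sqrtr_ge0 // ltW.
  by apply: ler_pM => //; [exact: mulr_ge0 | rewrite ler_pM2l].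
pose u := rho / (32 * R).
have uE : u * (32 * R) = rho by rewrite divfK // gt_eqF // mulr_gt0.
have u0 : 11 / 8 <= u by rewrite ler_pdivlMr ?mulr_gt0 //; lra.
pose N := Num.truncn (2 * u - 3 / 8).
have /andP[N1 N2] : N%:R <= 2 * u - 3 / 8 < N.+1%:R by apply: truncn_itv; lra.
have hN : (N ^ 2 <= size s)%N.
  apply: (in_disc_count hP hT (s := rho)) => [T /hs //|].
  have : 16 * R * N%:R <= 16 * R * (2 * u - 3 / 8) by rewrite ler_pM2l // mulr_gt0.
  lra.
have hn : u ^+ 2 <= (size s)%:R.
  move: hN; rewrite -(ler_nat K) natrX; apply: le_trans.
  move: N2; rewrite -natr1 => N2; apply: lerXn2r; rewrite ?nnegrE //; lra.
have sgB : B <= sg.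
  by apply: le_of_sqr_le; rewrite ?sqrtr_ge0 // sg2; move: hrho; rewrite /rho0; lra.
have hfinal : m * nb%:R <= e * (size s)%:R.
  apply: (@le_trans _ _ (e * u ^+ 2)); last by rewrite ler_pM2l.
  apply: (@le_trans _ _ (m * (C * sg ^+ 3))); first exact: ler_wpM2l.
  have mC : m * C = B * e / (32 * R) ^+ 2.
    by rewrite /B; field; rewrite !gt_eqF // mulr_gt0.
  have -> : u ^+ 2 = sg * sg ^+ 3 / (32 * R) ^+ 2.
    have -> : sg * sg ^+ 3 = (sg ^+ 2) ^+ 2 by ring.
    by rewrite sg2 /u; field; rewrite gt_eqF // mulr_gt0.
  rewrite mulrA mC; set D := (32 * R) ^+ 2.
  have -> : B * e / D * sg ^+ 3 = e * (B * sg ^+ 3 / D) by ring.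
  rewrite ler_pM2l // ler_pM2r ?invr_gt0 ?exprn_gt0 ?mulr_gt0 //.
  by rewrite ler_wpM2r // exprn_ge0 // sqrtr_ge0.
have n0 : 0 < (size s)%:R :> K.
  by apply: lt_le_trans hn; rewrite exprn_gt0 //; lra.
rewrite /mean_area ler_pdivlMr // mulrBl.
apply: le_trans hcomp; move: hfinal; rewrite -hcount natrD.
lra.
Qed.

End AverageBound.

Section AverageMain.
Context {K : realType} (r R : K) (P : set (plane K)) (TT : set (triangle K)).
Hypothesis hP : rR_system r R P.
Hypothesis hT : delone_triangulation P TT.

Lemma average_area_ge (G : set (set (triangle K))) :
  partition G id TT -> (forall g, G g -> admissible_group r g) ->
  (Order.min (inf_nonobtuse_area TT) (2 * r ^+ 2)%:E <= average_area TT)%E.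
Proof.
move=> hG hadm.
have r2 : 0 <= 2 * r ^+ 2 by rewrite mulr_ge0 // sqr_ge0.
have V0 : (0 <= inf_nonobtuse_area TT)%E.
  by apply/ereal_infP => _ [T _ <-]; rewrite lee_fin area_ge0.
have VT T : TT T -> ~ obtuse T -> (inf_nonobtuse_area TT <= (area T)%:E)%E.
  by move=> TT_T oT; apply: ereal_inf_lbound; exists T.
case: (inf_nonobtuse_area TT) V0 VT => [v| |] // v0 VT.
  rewrite -EFin_min; apply: (average_lower_bound hP hT hG hadm).
  - by rewrite le_min r2 andbT -lee_fin.
  - by rewrite ge_min lexx orbT.
  - by move=> T TT_T /(VT _ TT_T); rewrite lee_fin ge_min => ->.
rewrite min_r ?leey //; apply: (average_lower_bound hP hT hG hadm) => //.
by move=> T TT_T /(VT _ TT_T); rewrite leye_eq.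
Qed.

End AverageMain.

(** * The integer lattice *)
Section IntegerLattice.
Context {K : realType}.
Implicit Types (a b k u v : int) (T U : triangle K) (p q x y z c : plane K).

Definition pt (s t : K) : plane K := \row_j (if j == 0 then s else t).
Definition lattice : set (plane K) := [set x | exists a b, x = pt a%:~R b%:~R].
Definition triangle_of p q x : triangle K :=
  [ffun i : 'I_3 => if i == 0 then p else if i == 1 then q else x].
Definition lower a b := triangle_of (pt a%:~R b%:~R) (pt (a + 1)%:~R b%:~R)
  (pt (a + 1)%:~R (b + 1)%:~R).
Definition upper a b := triangle_of (pt a%:~R b%:~R) (pt (a + 1)%:~R (b + 1)%:~R)
  (pt a%:~R (b + 1)%:~R).
Definition lattice_triangles : set (triangle K) :=
  [set T | exists a b, T = lower a b \/ T = upper a b].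

Lemma pt0 (s t : K) : pt s t 0 0 = s. Proof. by rewrite mxE. Qed.
Lemma pt1 (s t : K) : pt s t 0 1 = t. Proof. by rewrite mxE. Qed.

Lemma pt_inj a b a' b' : pt a%:~R b%:~R = pt a'%:~R b'%:~R -> a = a' /\ b = b'.
Proof.
move=> h; have := congr1 (fun v : plane K => v 0 0) h.
have := congr1 (fun v : plane K => v 0 1) h.
by rewrite !pt0 !pt1 => /intr_inj -> /intr_inj ->.
Qed.

Lemma lattice_pt a b : lattice (pt a%:~R b%:~R).
Proof. by exists a, b. Qed.

Lemma triangle_ofE p q x :
  [/\ triangle_of p q x 0 = p, triangle_of p q x 1 = q & triangle_of p q x 2 = x].
Proof. by split; rewrite ffunE. Qed.

Lemma ordS3 : ((ordS 0 = 1 :> 'I_3) * (ord_pred 0 = 2 :> 'I_3) * (ordS 1 = 2 :> 'I_3) *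
  (ord_pred 1 = 0 :> 'I_3) * (ordS 2 = 0 :> 'I_3) * (ord_pred 2 = 1 :> 'I_3))%type.
Proof. by do !split; apply: val_inj. Qed.

Lemma ord3_cases (Q : 'I_3 -> Prop) : Q 0 -> Q 1 -> Q 2 -> forall i, Q i.
Proof.
by move=> q0 q1 q2 i; case: (ord3P 0 i) => ->; rewrite ?ordS3.
Qed.

Lemma vertices_triangle_of p q x :
  vertices (triangle_of p q x) = [set y | [\/ y = p, y = q | y = x]].
Proof.
have [e0 e1 e2] := triangle_ofE p q x.
apply/seteqP; split=> [_ [i _ <-]|y [] ->].
- move: i; apply: ord3_cases; rewrite ?e0 ?e1 ?e2;
    by [constructor 1|constructor 2|constructor 3].
- by exists 0.
- by exists 1.
- by exists 2.
Qed.

Lemma det_triangle_of p q x : det (triangle_of p q x) = cross (q - p) (x - p).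
Proof. by rewrite /det; have [-> -> ->] := triangle_ofE p q x. Qed.

Lemma det_lower a b : det (lower a b) = 1.
Proof. by rewrite det_triangle_of /pt; coords => /=; rewrite !intrD; ring. Qed.

Lemma det_upper a b : det (upper a b) = 1.
Proof. by rewrite det_triangle_of /pt; coords => /=; rewrite !intrD; ring. Qed.

Lemma det_lattice T : lattice_triangles T -> det T = 1.
Proof. by move=> [a [b [] ->]]; [exact: det_lower | exact: det_upper]. Qed.

Lemma lattice_nondegenerate T : lattice_triangles T -> nondegenerate T.
Proof. by move=> /det_lattice dT; rewrite /Defs.nondegenerate -/(det T) dT oner_neq0. Qed.

Lemma area_lattice T : lattice_triangles T -> area T = 1 / 2.
Proof. by move=> /det_lattice; rewrite areaE => ->; rewrite normr1. Qed.

Lemma lattice_nonobtuse T : lattice_triangles T -> ~ obtuse T.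
Proof.
move=> TT_T /(obtuseP (lattice_nondegenerate TT_T))[i]; apply/negP; rewrite -leNgt.
move: i; case: TT_T => a [b []] ->; apply: ord3_cases; rewrite /dot_at !ordS3;
  rewrite /lower /upper !ffunE /pt /=; coords => /=; rewrite !intrD; lra.
Qed.

Lemma int_sqr_ge1 k : k != 0 -> 1 <= (k%:~R : K) ^+ 2.
Proof.
move=> k0; rewrite -rmorphXn /= ler1z.
by rewrite -gtz0_ge1 lt_neqAle sqr_ge0 andbT eq_sym expf_neq0.
Qed.

Lemma half_int_sqr k a : 1 / 4 <= (k%:~R - (a%:~R + 1 / 2) : K) ^+ 2.
Proof.
have [h|h] := leP k a.
  have : (k%:~R : K) <= a%:~R by rewrite ler_int.
  by nra.
have : (a + 1)%:~R <= (k%:~R : K) by rewrite ler_int -ltzD1 ltrD2r.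
rewrite intrD; nra.
Qed.

Lemma half_int_eq k a : (k%:~R - (a%:~R + 1 / 2) : K) ^+ 2 = 1 / 4 -> k = a \/ k = a + 1.
Proof.
move=> h.
have : ((k - a)%:~R - 0 : K) * ((k - (a + 1))%:~R) = 0 by rewrite !intrB !intrD; lra.
rewrite subr0 -intrM => /eqP; rewrite intr_eq0 mulf_eq0 !subr_eq0.
by move=> /orP[] /eqP ->; [left|right].
Qed.

Lemma nearest_int_pair u v (c : K) : u <> v ->
  (u%:~R - c) ^+ 2 = (v%:~R - c) ^+ 2 ->
  (forall k, (u%:~R - c) ^+ 2 <= (k%:~R - c) ^+ 2) -> exists a, c = a%:~R + 1 / 2.
Proof.
wlog uv : u v / u < v => [hw ne h hmin|ne h hmin].
  have [uv|vu|//] := ltgtP u v; first exact: hw uv ne h hmin.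
  apply: (hw v u vu) => //; first exact: nesym.
  by move=> k; rewrite -h.
exists u.
have vu : (u + 1)%:~R <= (v%:~R : K) by rewrite ler_int -ltzD1 ltrD2r.
have := hmin (u + 1); move: vu; rewrite intrD => vu hu.
have hs : (v%:~R - u%:~R) * (u%:~R + v%:~R - 2 * c) = 0 by lra.
have : u%:~R + v%:~R - 2 * c = 0.
  by move/eqP : hs; rewrite mulf_eq0 => /orP[|] /eqP //; lra.
lra.
Qed.

Definition square a b : set (plane K) :=
  [set x | exists k l, [/\ x = pt k%:~R l%:~R, k = a \/ k = a + 1 & l = b \/ l = b + 1]].

Lemma lattice_system : rR_system (1 / 2) 1 lattice.
Proof.
split; [lra | lra | |].
- move=> p q [a [b ->]] [a' [b' ->]] pq; rewrite -subset0 => z [].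
  rewrite /open_disc /= => hp hq.
  have : edist (pt a%:~R b%:~R) (pt a'%:~R b'%:~R) < 1.
    apply: le_lt_trans (edist_triangle z _ _) _; rewrite [edist z _]edistC; lra.
  rewrite edist_lt // expr1n; apply/negP; rewrite -leNgt.
  rewrite /sqd /pt; coords => /=; rewrite -!intrB -!expr2.
  have s1 := sqr_ge0 ((a' - a)%:~R : K); have s2 := sqr_ge0 ((b' - b)%:~R : K).
  have [aE|/int_sqr_ge1] := eqVneq (a' - a) 0; last by lra.
  have [bE|/int_sqr_ge1] := eqVneq (b' - b) 0; last by lra.
  by case: pq; rewrite (subr0_eq aE) (subr0_eq bE).
- rewrite -subTset => z _.
  have h (t : K) : (Num.floor (t + 1 / 2))%:~R <= t + 1 / 2 < (Num.floor (t + 1 / 2))%:~R + 1.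
    by have := floor_itv (t + 1 / 2); rewrite intrD.
  exists (pt (Num.floor (z 0 0 + 1 / 2))%:~R (Num.floor (z 0 1 + 1 / 2))%:~R).
    by eexists; eexists.
  rewrite /disc /= edist_le // expr1n /sqd /pt; coords => /=.
  move: (h (z 0 0)) (h (z 0 1)) => /andP[? ?] /andP[? ?]; nra.
Qed.

Lemma sqd_pt c (k l : K) : sqd c (pt k l) = (k - c 0 0) ^+ 2 + (l - c 0 1) ^+ 2.
Proof. by rewrite /sqd /pt; coords => /=; ring. Qed.

Lemma square_delone a b : delone_vertices lattice (square a b).
Proof.
pose c := pt (a%:~R + 1 / 2) (b%:~R + 1 / 2).
have s0 : 0 <= Num.sqrt (1 / 2) :> K := sqrtr_ge0 _.
have s2 : Num.sqrt (1 / 2) ^+ 2 = 1 / 2 :> K by rewrite sqr_sqrtr //; lra.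
exists c, (Num.sqrt (1 / 2)); split.
- rewrite -subset0 => x [[k [l ->]]]; rewrite /open_disc /= edist_lt // s2 sqd_pt !pt0 !pt1.
  have := half_int_sqr k a; have := half_int_sqr l b; lra.
- apply/seteqP; split=> x.
    move=> [k [l [-> hk hl]]]; split; first by exists k, l.
    apply/edist_eq => //; rewrite s2 sqd_pt !pt0 !pt1.
    by case: hk => ->; case: hl => ->; rewrite ?intrD; field.
  move=> [[k [l ->]] /(edist_eq _ _ s0)]; rewrite s2 sqd_pt !pt0 !pt1 => h.
  have h1 := half_int_sqr k a; have h2 := half_int_sqr l b.
  exists k, l; split=> //; apply: half_int_eq; lra.
- exists (pt a%:~R b%:~R), (pt (a + 1)%:~R b%:~R), (pt a%:~R (b + 1)%:~R); split.
  + by exists a, b; split=> //; left.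
  + by exists (a + 1), b; split=> //; [right | left].
  + by exists a, (b + 1); split=> //; [left | right].
  + by rewrite /pt; coords => /=; rewrite !intrD -subr_eq0; apply/eqP => h; lra.
Qed.

(** The points of the lattice nearest to a centre are obtained by rounding the two
    coordinates independently, and they are not collinear only when both
    coordinates are half-integers. *)
Lemma delone_square V : delone_vertices lattice V -> exists a b, V = square a b.
Proof.
move=> dV; have [c [Q [_ he hV]]] := delone_circle lattice_system dV.
have exch k l k' l' : V (pt k%:~R l%:~R) -> V (pt k'%:~R l'%:~R) ->
    (k%:~R - c 0 0) ^+ 2 = (k'%:~R - c 0 0) ^+ 2 /\
    (l%:~R - c 0 1) ^+ 2 = (l'%:~R - c 0 1) ^+ 2.
  move=> /hV[_]; rewrite sqd_pt => h1 /hV[_]; rewrite sqd_pt => h2.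
  have := he _ (lattice_pt k l'); have := he _ (lattice_pt k' l); rewrite !sqd_pt.
  split; lra.
have near_x k l n : V (pt k%:~R l%:~R) -> (k%:~R - c 0 0) ^+ 2 <= (n%:~R - c 0 0) ^+ 2.
  move=> /hV[_]; rewrite sqd_pt => h1.
  have := he _ (lattice_pt n l); rewrite sqd_pt; lra.
have near_y k l n : V (pt k%:~R l%:~R) -> (l%:~R - c 0 1) ^+ 2 <= (n%:~R - c 0 1) ^+ 2.
  move=> /hV[_]; rewrite sqd_pt => h1.
  have := he _ (lattice_pt k n); rewrite sqd_pt; lra.
have [_ [_ [_ _ [x [y [z [Vx Vy Vz nc]]]]]]] := dV.
have VP w : V w -> exists k l, w = pt k%:~R l%:~R by move=> /hV[].
have [x0 [x1 xE]] := VP x Vx; have [y0 [y1 yE]] := VP y Vy; have [z0 [z1 zE]] := VP z Vz.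
rewrite {}xE in Vx nc; rewrite {}yE in Vy nc; rewrite {}zE in Vz nc.
have [a ca] : exists a, c 0 0 = a%:~R + 1 / 2.
  have [e1|n1] := eqVneq x0 y0; last first.
    apply: (nearest_int_pair (elimN eqP n1)); first exact: (exch _ _ _ _ Vx Vy).1.
    by move=> n; exact: near_x Vx.
  have [e2|n2] := eqVneq x0 z0; last first.
    apply: (nearest_int_pair (elimN eqP n2)); first exact: (exch _ _ _ _ Vx Vz).1.
    by move=> n; exact: near_x Vx.
  by move: nc; rewrite -e1 -e2 /pt; coords => /=; rewrite subrr mul0r mulr0 subrr eqxx.
have [b cb] : exists b, c 0 1 = b%:~R + 1 / 2.
  have [e1|n1] := eqVneq x1 y1; last first.
    apply: (nearest_int_pair (elimN eqP n1)); first exact: (exch _ _ _ _ Vx Vy).2.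
    by move=> n; exact: near_y Vx.
  have [e2|n2] := eqVneq x1 z1; last first.
    apply: (nearest_int_pair (elimN eqP n2)); first exact: (exch _ _ _ _ Vx Vz).2.
    by move=> n; exact: near_y Vx.
  by move: nc; rewrite -e1 -e2 /pt; coords => /=; rewrite subrr mul0r mulr0 subrr eqxx.
exists a, b.
have QE : Q = 1 / 2.
  have hx := near_x _ _ a Vx; have hy := near_y _ _ b Vx.
  have [_] := (hV _).1 Vx; rewrite sqd_pt ca cb in hx hy *.
  have h1 := half_int_sqr x0 a; have h2 := half_int_sqr x1 b.
  lra.
apply/seteqP; split=> w.
  move=> /hV[[k [l ->]]]; rewrite sqd_pt ca cb QE => h.
  have h1 := half_int_sqr k a; have h2 := half_int_sqr l b.
  exists k, l; split=> //; apply: half_int_eq; lra.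
move=> [k [l [-> hk hl]]]; apply/hV; split; first by exists k, l.
by rewrite sqd_pt ca cb QE; case: hk => ->; case: hl => ->; rewrite ?intrD; field.
Qed.

Lemma lower_square a b : vertices (lower a b) `<=` square a b.
Proof.
rewrite vertices_triangle_of => x [] ->.
- by exists a, b; split; [|left|left].
- by exists (a + 1), b; split; [|right|left].
- by exists (a + 1), (b + 1); split; [|right|right].
Qed.

Lemma upper_square a b : vertices (upper a b) `<=` square a b.
Proof.
rewrite vertices_triangle_of => x [] ->.
- by exists a, b; split; [|left|left].
- by exists (a + 1), (b + 1); split; [|right|right].
- by exists a, (b + 1); split; [|left|right].
Qed.

Lemma square_triangles T a b : lattice_triangles T -> vertices T `<=` square a b ->
  T = lower a b \/ T = upper a b.
Proof.
move=> [a' [b' hT]] TV; suff [-> ->] : a = a' /\ b = b' by [].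
have [k [l [/pt_inj[kE lE] hk hl]]] : square a b (pt a'%:~R b'%:~R).
  by apply: TV; case: hT => ->; rewrite vertices_triangle_of; constructor 1.
have [k' [l' [/pt_inj[kE' lE'] hk' hl']]] : square a b (pt (a' + 1)%:~R (b' + 1)%:~R).
  by apply: TV; case: hT => ->; rewrite vertices_triangle_of; [constructor 3|constructor 2].
by move: hk hl hk' hl'; rewrite -kE -lE -kE' -lE'; lia.
Qed.

Lemma interior_push (A : set (plane K)) z (v : plane K) : interior A z ->
  exists2 e : K, 0 < e & A (z + e *: v).
Proof.
move=> Az; have h : (fun t : K => z + t *: v) @ (0 : K) --> z.
  suff : (fun t : K => z + t *: v) @ (0 : K) --> z + (0 : K) *: v.
    by rewrite scale0r addr0.
  apply: (cvgD (F := nbhs (0 : K))); first exact: (cvg_cst _ (F := nbhs (0 : K))).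
  exact: (@scalel_continuous _ _ v 0).
have : \forall t \near (0 : K), A (z + t *: v) by exact: h.
move=> /nbhs_ballP[e /= e0 he]; exists (e / 2); first by rewrite divr_gt0.
by apply: he; rewrite /ball /= sub0r normrN gtr0_norm ?divr_gt0 // ltr_pdivrMr //; lra.
Qed.

Lemma hull_lower a b z : hull (vertices (lower a b)) z <->
  [/\ b%:~R <= z 0 1, z 0 0 <= a%:~R + 1 & z 0 1 - b%:~R <= z 0 0 - a%:~R].
Proof.
have nT : nondegenerate (lower a b) by apply: lattice_nondegenerate; exists a, b; left.
have [e0 e1 e2] : [/\ bary (lower a b) 0 z = a%:~R + 1 - z 0 0,
   bary (lower a b) 1 z = (z 0 0 - a%:~R) - (z 0 1 - b%:~R)
   & bary (lower a b) 2 z = z 0 1 - b%:~R].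
  by split; rewrite /bary det_lower divr1 !ordS3 /side_of /lower !ffunE /pt; coords => /=;
    rewrite !intrD; ring.
split.
  move=> /(hull_triangleP _ nT) h; have := h 0; have := h 1; have := h 2.
  by rewrite e0 e1 e2 => *; split; lra.
move=> [h1 h2 h3]; apply/(hull_triangleP _ nT); apply: ord3_cases; rewrite ?e0 ?e1 ?e2; lra.
Qed.

Lemma hull_upper a b z : hull (vertices (upper a b)) z <->
  [/\ a%:~R <= z 0 0, z 0 1 <= b%:~R + 1 & z 0 0 - a%:~R <= z 0 1 - b%:~R].
Proof.
have nT : nondegenerate (upper a b) by apply: lattice_nondegenerate; exists a, b; right.
have [e0 e1 e2] : [/\ bary (upper a b) 0 z = b%:~R + 1 - z 0 1,
   bary (upper a b) 1 z = z 0 0 - a%:~R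
   & bary (upper a b) 2 z = (z 0 1 - b%:~R) - (z 0 0 - a%:~R)].
  by split; rewrite /bary det_upper divr1 !ordS3 /side_of /upper !ffunE /pt; coords => /=;
    rewrite !intrD; ring.
split.
  move=> /(hull_triangleP _ nT) h; have := h 0; have := h 1; have := h 2.
  by rewrite e0 e1 e2 => *; split; lra.
move=> [h1 h2 h3]; apply/(hull_triangleP _ nT); apply: ord3_cases; rewrite ?e0 ?e1 ?e2; lra.
Qed.

Lemma lower_upper_disjoint a b :
  interior (hull (vertices (lower a b))) `&` interior (hull (vertices (upper a b))) = set0.
Proof.
rewrite -subset0 => z [/(interior_push (pt (- 1) 1)) [e e0 /hull_lower[_ _]]].
rewrite /pt; coords => /= h /interior_subset/hull_upper[_ _ h']; lra.
Qed.

Lemma square_triangulation a b : polygon_triangulation (square a b)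
  (lattice_triangles `&` [set T | vertices T `<=` square a b]).
Proof.
split.
- by move=> T [TT_T TV]; split=> //; exact: lattice_nondegenerate.
- move=> T U [TT_T /= TV] [TT_U /= UV].
  have [->|->] := square_triangles TT_T TV; have [->|->] := square_triangles TT_U UV => // _.
    exact: lower_upper_disjoint.
  by rewrite setIC lower_upper_disjoint.
- apply/seteqP; split=> z; first by move=> [T [_ /= TV]]; exact: hull_mono.
  have hs : hull (square a b) `<=`
      [set z | a%:~R <= z 0 0 <= a%:~R + 1 /\ b%:~R <= z 0 1 <= b%:~R + 1].
    apply: hull_sub => [x y s /andP[s0 s1]|x] /=.
      move=> [/andP[? ?] /andP[? ?]] [/andP[? ?] /andP[? ?]]; coords.
      by split; apply/andP; split; nra.
    move=> [k [l [-> hk hl]]]; rewrite pt0 pt1; case: hk => ->; case: hl => ->;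
      by rewrite ?intrD; split; apply/andP; split; lra.
  move=> /hs[/andP[h1 h2] /andP[h3 h4]].
  have [h|/ltW h] := leP (z 0 1 - b%:~R) (z 0 0 - a%:~R).
    exists (lower a b); last by apply/hull_lower.
    by split; [exists a, b; left | exact: lower_square].
  exists (upper a b); last by apply/hull_upper.
  by split; [exists a, b; right | exact: upper_square].
Qed.

Lemma lattice_delone : delone_triangulation lattice lattice_triangles.
Proof.
split.
  move=> T [a [b hT]]; exists (square a b); first exact: square_delone.
  by case: hT => ->; [exact: lower_square | exact: upper_square].
by move=> V /delone_square[a [b ->]]; exact: square_triangulation.
Qed.

Lemma lattice_average_le : (average_area lattice_triangles <= (1 / 2 : K)%:E)%E.
Proof.
rewrite /average_area limf_einfE; apply/ereal_supP => _ [V FV <-].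
have [rho _ Vrho] := pinfty_ex_gt0 FV.
apply: le_trans (ereal_inf_lbound (ex_intro2 _ _ rho Vrho erefl)) _.
rewrite lee_fin /mean_area.
have fin := finite_in_disc lattice_system lattice_delone rho.
set s := finmap.enum_fset _.
have -> : \sum_(T <- s) area T = (size s)%:R / 2.
  rewrite big_seq (eq_bigr (fun=> 1 / 2)); last first.
    move=> T Ts; apply: area_lattice.
    have h : (T \in s) = (T \in in_disc lattice_triangles rho) := in_fset_set fin T.
    by move: Ts; rewrite h inE => -[].
  by rewrite -big_seq big_const_seq count_predT iter_addr_0 mulr_natl; field.
have [->|n0] := eqVneq (size s)%:R (0 : K); first by rewrite !mul0r; lra.
by rewrite mulrAC divff // mul1r; lra.
Qed.

Lemma lattice_inf_area : inf_nonobtuse_area lattice_triangles = (1 / 2 : K)%:E.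
Proof.
rewrite /inf_nonobtuse_area (_ : [set _ | _ in _] = [set (1 / 2)%:E]) ?ereal_inf1 //.
apply/seteqP; split=> [_ [T [TT_T _] <-]|_ ->] /=; first by rewrite area_lattice.
have TT_T : lattice_triangles (lower 0 0) by exists 0, 0; left.
exists (lower 0 0); last by rewrite area_lattice.
by split=> //; exact: lattice_nonobtuse.
Qed.

End IntegerLattice.

Theorem theorem2p9 (K : realType) :
  (forall (r R : K) (P : set (plane K)) (TT : set (triangle K)),
     rR_system r R P ->
     R / r <= 2 * Num.sqrt 2 ->
     delone_triangulation P TT ->
     (exists G : set (set (triangle K)),
        partition G id TT /\ forall g, G g -> admissible_group r g) /\
     (Order.min (inf_nonobtuse_area TT) (2 * r ^+ 2)%:E
        <= average_area TT)%E) /\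
  (exists (r R : K) (P : set (plane K)) (TT : set (triangle K)),
     [/\ rR_system r R P,
         R / r <= 2 * Num.sqrt 2,
         delone_triangulation P TT
       & average_area TT =
           Order.min (inf_nonobtuse_area TT) (2 * r ^+ 2)%:E]).
Proof.
split.
  move=> r R P TT hP hR hT; have [G [hG hadm]] := admissible_partition hP hR hT.
  by split; [exists G | exact: (average_area_ge hP hT hG hadm)].
have sqrt2 : 1 <= Num.sqrt 2 :> K.
  by apply: le_of_sqr_le; rewrite ?sqrtr_ge0 // sqr_sqrtr // expr1n; lra.
have ratio : 1 / (1 / 2) <= 2 * Num.sqrt 2 :> K by lra.
have hmin : Order.min (inf_nonobtuse_area lattice_triangles) (2 * (1 / 2) ^+ 2)%:E
    = (1 / 2 : K)%:E.
  by rewrite lattice_inf_area -EFin_min (_ : 2 * (1 / 2) ^+ 2 = 1 / 2) ?minxx //; field.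
exists (1 / 2), 1, lattice, lattice_triangles; split=> //.
- exact: lattice_system.
- exact: lattice_delone.
- rewrite hmin; apply/eqP; rewrite eq_le lattice_average_le /= -hmin.
  have [G [hG hadm]] := admissible_partition lattice_system ratio lattice_delone.
  exact: (average_area_ge lattice_system lattice_delone hG hadm).
Qed.
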